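(* Let $\varGamma$ be a Conway-Coxeter frieze of zigzag type. Choose a rational number $\alpha=\frac{p}{q}\in(0,1)$ (irreducible) with $\varGamma=\varGamma_\alpha$, let $\bigl(\frac{x}{s},\frac{y}{r}\bigr)$ be the pair of parents of $\alpha$, and define the class $$V(\varGamma):=\begin{cases}\{V(\alpha),\ \overline{V(\alpha)}\} & \text{if } q \text{ is odd},\\ \{V(\alpha),\ V(i(\alpha))\} & \text{if } q \text{ and } x \text{ are even},\\ \{V(\alpha),\ V(i(\alpha)),\ \overline{V(i(\alpha))},\ \overline{V(\alpha)}\} & \text{if } q \text{ and } y \text{ are even}.\end{cases}$$ Then $V(\varGamma)$ is well-defined, i.e. it depends only on $\varGamma$ (up to equivalence of friezes) and not on the choice of $\alpha$. (Its members are regarded as Laurent polynomials in $t^{1/2}$ via $t=A^{-4}$; $V(\varGamma)$ is called the Jones polynomial of $\varGamma$.)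
   Context: **Parents, $LR$ words, $i$.** Irreducible fractions $\frac{a}{b},\frac{c}{d}$ (nonnegative denominators) are Farey neighbors if $bc-ad=1$; their mediant is $\frac{a}{b}\sharp\frac{c}{d}=\frac{a+c}{b+d}$. Every nonzero rational is the mediant of a unique (ordered) pair of Farey neighbors, its pair of parents. For $\alpha=\frac pq\in(0,1)$ irreducible, $i(\alpha)=\frac{q-p}{q}$. The bijection $\alpha\mapsto w(\alpha)$ from $\mathbb{Q}\cap(0,1)$ to words in $L,R$ is given by $w(\frac12)=\emptyset$ and, for parents $\frac{a}{b},\frac{c}{d}$ of $\alpha\ne\frac12$: $w(\alpha)=L\,w(\frac{c}{d})$ if $b<d$, $w(\alpha)=R\,w(\frac{a}{b})$ if $b>d$. **Friezes.** A Conway-Coxeter frieze (CCF) is an array of positive integers with rows $k=0,1,\ldots,m+1$, row $k$ having entries at integer positions $z\equiv k\pmod 2$ (up to a horizontal shift), such that rows $0$ and $m+1$ consist of $1$'s and every unit diamond with top $b$ at $(k-1,z)$, left $a$ at $(k,z-1)$, right $d$ at $(k,z+1)$, bottom $c$ at $(k+1,z)$ satisfies $ad-bc=1$. For an $LR$ word $w=w_1\cdots w_{m-1}$, $\varGamma(w)$ is the CCF with $m$ interior rows, unique up to horizontal translation, having a $1$ in row $k$ at position $z_k$ ($1\le k\le m$), where $z_{k+1}=z_k-1$ if $w_k=L$ and $z_{k+1}=z_k+1$ if $w_k=R$. A CCF is of zigzag type if it is some $\varGamma(w)$; $\varGamma_\alpha=\varGamma(w(\alpha))$. Two CCFs are equivalent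 if they are transformed into each other (up to horizontal translation) by the vertical or horizontal reflection or the composition of them. **Rational link diagrams and orientation.** Write $\alpha=[0,a_1,\ldots,a_n]=\cfrac{1}{a_1+\cfrac{1}{\ddots+\cfrac{1}{a_n}}}$ with positive integers $a_j$. Tangle diagrams have ends NW, NE, SW, SE. $[1]$ is the single-crossing tangle whose over-strand joins NW and SE; $[m]$ is the horizontal row and $1/[m]$ the vertical column of $m$ copies of $[1]$. Put $S_n=[a_n]$ if $n$ is even, $S_n=1/[a_n]$ if $n$ is odd; for $k=n-1,\ldots,1$ let $S_k$ be the horizontal sum of $S_{k+1}$ with $[a_k]$ if $k$ is even, and the vertical composition of $S_{k+1}$ with $1/[a_k]$ placed below it if $k$ is odd; $T(\alpha)=S_1$. $D(T(\alpha))$ is the link diagram obtained by joining NW to SW and NE to SE by simple outer arcs. It is a knot diagram if $q$ is odd and a two-component link diagram if $q$ is even. If $q$ is odd, either orientation may be used. If $q$ is even, the two closing arcs lie on different components, and $D(T(\alpha))$ is oriented so that one closing arc runs upward and the other downward. $\mathrm{wr}(\alpha)$ is the writhe of this oriented diagram. **Jones polynomial.** $V(\alpha)=(-A^3)^{-\mathrm{wr}(\alpha)}\langle D(T(\alpha))\rangle$, where $\langle\ \rangle$ is the Kauffman bracket in the variable $A$: each crossing resolves as $A$ times the $A$-smoothing plus $A^{-1}$ times the $B$-smoothing (the $A$-smoothing joins the two regions swept out when the over-strand is rotated counterclockwise), $\langle D\coprod\bigcirc\rangle=(-A^2-A^{-2})\langle D\rangle$, $\langle\bigcirc\rangle=1$.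 The bar means replacing $A$ by $A^{-1}$. *)

(* Defs.v *)
From HB Require Import structures.
From mathcomp Require Import all_boot all_order all_algebra.
From mathcomp Require Import generic_quotient fraction.

Set Implicit Arguments.
Unset Strict Implicit.
Unset Printing Implicit Defensive.
Import Order.TTheory GRing.Theory Num.Theory.
Local Open Scope ring_scope.
Local Open Scope quotient_scope.

(* The condition b * c - a * d = 1 makes both a/b and c/d irreducible;
   b = 0 or d = 0 stands for 1/0. *)
Definition farey_neighbors (a b c d : int) : Prop :=
  [/\ 0 <= b, 0 <= d & b * c - a * d = 1].

Definition parents (alpha : rat) (a b c d : int) : Prop :=
  farey_neighbors a b c d /\ alpha = (a + c)%:~R / (b + d)%:~R.

Definition irat (alpha : rat) : rat :=
  (denq alpha - numq alpha)%:~R / (denq alpha)%:~R.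

Inductive letter := L | R.

(* Graph of the map alpha |-> w(alpha). *)
Inductive word : rat -> seq letter -> Prop :=
| word_half : word (1 / 2%:R) [::]
| word_L (alpha : rat) (a b c d : int) (w : seq letter) :
    alpha != 1 / 2%:R -> parents alpha a b c d -> b < d ->
    word (c%:~R / d%:~R) w -> word alpha (L :: w)
| word_R (alpha : rat) (a b c d : int) (w : seq letter) :
    alpha != 1 / 2%:R -> parents alpha a b c d -> d < b ->
    word (a%:~R / b%:~R) w -> word alpha (R :: w).

(* Row k of the array occupies the positions z with z = k + shift mod 2;
   the values of [entry] elsewhere are irrelevant. *)
Record frieze := Frieze {
  interior : nat;
  shift : int;
  entry :> nat -> int -> int }.

Definition on_lattice (F : frieze) (k : nat) (z : int) : bool :=
  (k <= (interior F).+1)%N && (2 %| z - k%:Z - shift F)%Z.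

Definition is_CCF (F : frieze) : Prop :=
  [/\ forall k z, on_lattice F k z -> 0 < F k z,
      forall z, on_lattice F 0 z -> F 0%N z = 1,
      forall z, on_lattice F (interior F).+1 z -> F (interior F).+1 z = 1
    & forall k z, (1 <= k <= interior F)%N -> on_lattice F k.-1 z ->
        F k (z - 1) * F k (z + 1) - F k.-1 z * F k.+1 z = 1].

Definition step (l : letter) : int := if l is L then -1 else 1.

(* F is the frieze Gamma(w), which is determined up to translation. *)
Definition is_Gamma (w : seq letter) (F : frieze) : Prop :=
  [/\ is_CCF F, interior F = (size w).+1 &
    exists z : nat -> int,
      (forall k, (1 <= k <= interior F)%N ->
         on_lattice F k (z k) /\ F k (z k) = 1) /\
      (forall k, (1 <= k <= size w)%N ->
         z k.+1 = z k + step (nth L w k.-1))].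

Definition zigzag_type (F : frieze) : Prop := exists w, is_Gamma w F.

Definition is_Gamma_rat (alpha : rat) (F : frieze) : Prop :=
  exists2 w, word alpha w & is_Gamma w F.

(* v: apply the vertical reflection; h: apply the horizontal one;
   t: translation. *)
Definition frieze_equiv (F G : frieze) : Prop :=
  interior F = interior G /\
  exists (v h : bool) (t : int), forall (k : nat) (z : int),
    (k <= (interior F).+1)%N ->
    let k' := if v then ((interior F).+1 - k)%N else k in
    let z' := (if h then - z else z) + t in
    on_lattice G k' z' = on_lattice F k z /\
    (on_lattice F k z -> G k' z' = F k z).

(* The ambient field Q(A), which contains Z[A, A^-1]. *)
Definition K := {fraction {poly int}}.

Definition A : K := FracField.tofrac ('X : {poly int}).

Definition ev (p : {poly int}) (x : K) : K :=
  (map_poly (fun c : int => c%:~R : K) p).[x].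

(* The substitution A |-> A^-1, through an arbitrary representative of f as
   a fraction of polynomials; [bar_frac] below shows that the choice does not
   matter. *)
Definition bar (f : K) : K :=
  ev \n_(repr f) A^-1 / ev \d_(repr f) A^-1.

(* Elements of Z[t^(1/2), t^(-1/2)], where t = A^-4 and t^(1/2) = A^-2. *)
Definition laurent_sqrt_t (f : K) : Prop :=
  exists (p : {poly int}) (n : nat), f = ev p (A ^- 2) / (A ^- 2) ^+ n.

(* A corner of a crossing is a pair (is south, is east). *)
Definition corner := (bool * bool)%type.
Definition NW : corner := (false, false).
Definition NE : corner := (false, true).
Definition SW : corner := (true, false).
Definition SE : corner := (true, true).

(* (i, c) is the corner c of the i-th crossing. *)
Definition endpoint := (nat * corner)%type.

(* Every crossing is a copy of [1]: its over-strand joins its corners NW and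
   SE, its under-strand NE and SW.  [tjoins] lists the arcs that join corners
   of crossings outside the crossings, and [tend] gives the corners at which
   the four ends of the tangle sit. *)
Record tangle := Tangle {
  tcross : nat;
  tjoins : seq (endpoint * endpoint);
  tend : corner -> endpoint }.

Definition cross : tangle := Tangle 1 [::] (fun c => (0%N, c)).

Definition shift_end (n : nat) (x : endpoint) : endpoint := ((n + x.1)%N, x.2).

Definition juxt_joins (S T : tangle) : seq (endpoint * endpoint) :=
  tjoins S ++ [seq (shift_end (tcross S) e.1, shift_end (tcross S) e.2)
              | e <- tjoins T].

(* S on the left of T *)
Definition hsum (S T : tangle) : tangle :=
  let endT c := shift_end (tcross S) (tend T c) in
  Tangle (tcross S + tcross T)
    ((tend S NE, endT NW) :: (tend S SE, endT SW) :: juxt_joins S T)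
    (fun c => if c.2 then endT c else tend S c).

(* S above T *)
Definition vsum (S T : tangle) : tangle :=
  let endT c := shift_end (tcross S) (tend T c) in
  Tangle (tcross S + tcross T)
    ((tend S SW, endT NW) :: (tend S SE, endT NE) :: juxt_joins S T)
    (fun c => if c.1 then endT c else tend S c).

Definition sum_at (k : nat) : tangle -> tangle -> tangle :=
  if odd k then vsum else hsum.

(* [m] for even k and 1/[m] for odd k, where m > 0 *)
Definition twist (k m : nat) : tangle :=
  iter m.-1 (fun T => sum_at k T cross) cross.

(* The tangle S_k, where s = (a_k, ..., a_n) is nonempty. *)
Fixpoint rational_tangle (k : nat) (s : seq nat) : tangle :=
  match s with
  | [::] => cross
  | [:: a] => twist k a
  | a :: s' => sum_at k (rational_tangle k.+1 s') (twist k a)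
  end.

Fixpoint cfrac_rec (n p q : nat) : seq nat :=
  if n is n'.+1 then
    if p == 0%N then [::] else (q %/ p)%N :: cfrac_rec n' (q %% p) p
  else [::].

(* The entries a_1, ..., a_n of alpha = [0, a_1, ..., a_n], computed by the
   Euclidean algorithm; see [cfracK] below.  The other expansion of alpha,
   [0, a_1, ..., a_n - 1, 1], describes the same tangle diagram. *)
Definition cfrac (alpha : rat) : seq nat :=
  cfrac_rec `|numq alpha|%N `|numq alpha|%N `|denq alpha|%N.

Definition T (alpha : rat) : tangle := rational_tangle 1 (cfrac alpha).

Record diagram := Diagram {
  dcross : nat;
  djoins : seq (endpoint * endpoint) }.

Definition D (S : tangle) : diagram :=
  Diagram (tcross S)
    ((tend S NW, tend S SW) :: (tend S NE, tend S SE) :: tjoins S).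

Definition pt (n : nat) (x : 'I_n * corner) : endpoint := (val x.1, x.2).

(* The number of circles formed by arcs between the corners of n crossings. *)
Definition circles (n : nat) (arcs : seq (endpoint * endpoint)) : nat :=
  n_comp [rel x y : 'I_n * corner |
           ((pt x, pt y) \in arcs) || ((pt y, pt x) \in arcs)] predT.

(* Turning the over-strand NW-SE counterclockwise sweeps the regions W and E,
   so that the A-smoothing consists of the arcs NW-NE and SW-SE. *)
Definition smoothA (i : nat) : seq (endpoint * endpoint) :=
  [:: ((i, NW), (i, NE)); ((i, SW), (i, SE))].
Definition smoothB (i : nat) : seq (endpoint * endpoint) :=
  [:: ((i, NW), (i, SW)); ((i, NE), (i, SE))].

(* The bracket of a diagram on n crossings of which only the first j are
   left unresolved. *)
Fixpoint bracket_rec (n j : nat) (arcs : seq (endpoint * endpoint)) : K :=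
  if j is i.+1 then
    A * bracket_rec n i (smoothA i ++ arcs) +
    A^-1 * bracket_rec n i (smoothB i ++ arcs)
  else (- A ^+ 2 - A ^- 2) ^+ (circles n arcs).-1.

Definition bracket (E : diagram) : K :=
  bracket_rec (dcross E) (dcross E) (djoins E).

(* o x tells whether the strand through the corner x of a crossing runs into
   that crossing at x. *)
Definition is_orientation (E : diagram)
    (o : {ffun 'I_(dcross E) * corner -> bool}) : bool :=
  [forall i, (o (i, NW) != o (i, SE)) && (o (i, NE) != o (i, SW))] &&
  [forall x, forall y, ((pt x, pt y) \in djoins E) ==> (o x != o y)].

(* The strands NW-SE (over) and NE-SW (under) form a negative crossing when
   both run downward or both run upward, and a positive one otherwise. *)
Definition writhe (E : diagram) (o : {ffun 'I_(dcross E) * corner -> bool}) :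
    int :=
  \sum_(i < dcross E) (if o (i, NW) == o (i, NE) then -1 else 1).

(* One of the two closing arcs of D(S) runs upward and the other downward:
   the arc NW-SW runs upward when it enters S at NW, and likewise for the
   arc NE-SE. *)
Definition opposite_closing_arcs (S : tangle)
    (o : {ffun 'I_(dcross (D S)) * corner -> bool}) : bool :=
  [forall x, forall y,
     (pt x == tend S NW) && (pt y == tend S NE) ==> (o x != o y)].

(* Each admissible orientation gives the same writhe: the remaining choices
   differ by a reversal of all the components. *)
Definition wr (alpha : rat) : int :=
  if [pick o | is_orientation (E := D (T alpha)) o &&
               ((2 %| denq alpha)%Z ==> opposite_closing_arcs (S := T alpha) o)]
    is Some o then writhe o else 0.

Definition V (alpha : rat) : K :=
  (- A ^+ 3) ^ (- wr alpha) * bracket (D (T alpha)).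

Definition Vclass (alpha : rat) (x y : int) (f : K) : Prop :=
  [\/ ~~ (2 %| denq alpha)%Z /\ f \in [:: V alpha; bar (V alpha)],
      [/\ (2 %| denq alpha)%Z, (2 %| x)%Z
        & f \in [:: V alpha; V (irat alpha)]]
    | [/\ (2 %| denq alpha)%Z, (2 %| y)%Z
        & f \in [:: V alpha; V (irat alpha);
                    bar (V (irat alpha)); bar (V alpha)]]].

(* An admissible choice of alpha (and of its parents) for the frieze F. *)
Definition represents (F : frieze) (alpha : rat) (x s y r : int) : Prop :=
  [/\ 0 < alpha < 1, is_Gamma_rat alpha F & parents alpha x s y r].

Definition cfrac_value (s : seq nat) : rat :=
  foldr (fun a v => (a%:R + v)^-1) 0 s.

Lemma cfrac_recP n p q : (p <= n)%N -> (p < q)%N ->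
  cfrac_value (cfrac_rec n p q) = p%:R / q%:R :> rat
  /\ all (leq 1) (cfrac_rec n p q).
Proof.
elim: n p q => [|n IHn] p q lepn ltpq /=.
  by move: lepn; rewrite leqn0 => /eqP->; rewrite mul0r.
have [->|p0] := eqVneq p 0%N; first by rewrite mul0r.
have pgt0 : (0 < p)%N by rewrite lt0n.
have ltmod : (q %% p < p)%N by rewrite ltn_mod.
have [/= -> ->] := IHn _ _ (leq_trans ltmod lepn : (q %% p <= n)%N) ltmod.
rewrite divn_gt0 // (ltnW ltpq); split=> //.
have pN0 : p%:R != 0 :> rat by rewrite pnatr_eq0.
rewrite {3}(divn_eq q p) natrD natrM -[p%:R / _]invf_div; congr (_^-1).
by rewrite mulrDl mulfK.
Qed.

Lemma cfracK (alpha : rat) : 0 < alpha < 1 ->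
  cfrac_value (cfrac alpha) = alpha /\ all (leq 1) (cfrac alpha).
Proof.
move=> /andP[alpha0 alpha1].
have n0 : 0 < numq alpha by rewrite numq_gt0.
have defn : (`|numq alpha|%N)%:Z = numq alpha by rewrite gtz0_abs.
have defd : (`|denq alpha|%N)%:Z = denq alpha by rewrite absz_denq.
have lt : (`|numq alpha| < `|denq alpha|)%N.
  rewrite -ltz_nat defn defd -(ltr_int rat).
  by rewrite -[ltRHS]mul1r -ltr_pdivrMr ?ltr0z ?denq_gt0 // divq_num_den.
have [-> ->] := cfrac_recP (leqnn _) lt; split=> //.
by rewrite !pmulrn defn defd divq_num_den.
Qed.

Lemma A_neq0 : A != 0.
Proof. by rewrite /A tofrac_eq0 polyX_eq0. Qed.

Lemma ev_neq0 (p : {poly int}) : p != 0 -> ev p A^-1 != 0.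
Proof.
move=> p0; pose n := size p.
pose r : {poly int} := \sum_(i < n) p`_i *: 'X^(n.-1 - i).
have r0 : r != 0.
  apply/eqP => /(congr1 (fun s : {poly int} => s`_0)).
  rewrite coef0 coef_sum.
  have n0 : (0 < n)%N by rewrite size_poly_gt0.
  have ltn : (n.-1 < n)%N by rewrite prednK.
  rewrite (bigD1 (Ordinal ltn)) //= subnn coefZ coefXn mulr1.
  rewrite big1 => [|i ni]; first by rewrite addr0 => /eqP;
    rewrite -lead_coefE lead_coef_eq0 (negPf p0).
  rewrite coefZ coefXn eq_sym subn_eq0 leqNgt.
  have -> : (i < n.-1)%N; last by rewrite mulr0.
  rewrite ltn_neqAle -ltnS prednK // ltn_ord andbT.
  by apply: contra ni => /eqP ei; apply/eqP/val_inj.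
have intrF (c : int) : FracField.tofrac c%:P = c%:~R :> K.
  by rewrite -[c in LHS]intz rmorph_int rmorph_int.
have evr : A ^+ n.-1 * ev p A^-1 = FracField.tofrac r.
  rewrite /ev /map_poly horner_poly mulr_sumr rmorph_sum /=.
  apply: eq_bigr => i _; rewrite -mul_polyC tofracM tofracXn intrF mulrCA.
  have lein : (i <= n.-1)%N by rewrite -ltnS prednK ?size_poly_gt0 ?ltn_ord.
  by rewrite exprVn -exprB // unitfE A_neq0.
apply: contra r0 => /eqP e0.
by rewrite -tofrac_eq0 -evr e0 mulr0.
Qed.

Lemma evM (p q : {poly int}) (x : K) : ev (p * q) x = ev p x * ev q x.
Proof. by rewrite /ev [map_poly _ _]rmorphM /= hornerM. Qed.

Lemma fracE (f : K) :
  f * FracField.tofrac \d_(repr f) = FracField.tofrac \n_(repr f).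
Proof.
rewrite -{1}[f]reprK; move: (repr f) => r; rewrite !piE.
apply/eqmodP; rewrite /= FracField.equivfE /FracField.mulf !numden_Ratio ?mulr1
  ?oner_eq0 ?mulf_neq0 ?denom_ratioP //.
by rewrite mulrC.
Qed.

Lemma bar_frac (p d : {poly int}) : d != 0 ->
  bar (FracField.tofrac p / FracField.tofrac d) = ev p A^-1 / ev d A^-1.
Proof.
move=> d0; set f := _ / _; have := fracE f; rewrite /bar.
move: (denom_ratioP (repr f)); set n := \n_ _; set e := \d_ _ => e0.
have dF : FracField.tofrac d != 0 by rewrite tofrac_eq0.
move/(congr1 ( *%R^~ (FracField.tofrac d))).
rewrite mulrAC /f divfK // -!tofracM => /eqP; rewrite tofrac_eq => /eqP E.
by apply/eqP; rewrite eqr_div ?ev_neq0 // -!evM E.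
Qed.

(* Main.v *)
From HB Require Import structures.
Require Import Defs.
From mathcomp Require Import all_boot all_order all_algebra.
From mathcomp Require Import generic_quotient fraction ring lra zify.

(** Everything is computed on the word w = w(alpha).

    The word determines alpha together with its parents ([farey]), and reading
    w from left to right, followed by a last letter L, also builds the tangle
    T(alpha) crossing by crossing, from the innermost one: L adds a crossing
    below, R adds one on the right ([T_rat_of_word]).  So both the bracket and
    the writhe of D(T(alpha)) are sums over walks along w.

    For the bracket, one follows the two closures of the tangle.  Adding a
    crossing acts on this pair by a matrix that depends on the letter only
    ([bracket_denom_L] and its three companions).  The Gram matrix
    ((delta, 1), (1, delta)) intertwines the matrices of both letters with their
    transposes, so that the bracket of a word is that of the reversed word
    ([kauffman_rev]); exchanging L with R amounts to exchanging A with its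
    inverse ([kauffman_flip]).

    For the writhe, the ends of an oriented tangle are, up to reversal, in one of
    three states, which the letters permute and which also decide the sign of
    each new crossing.  Reversing a word reverses the walk and keeps the signs
    ([flow_writhe_rev]); exchanging L with R reflects the states and negates the
    signs ([flow_writhe_flip]).  Modulo 2, the states are alpha and its two
    parents; the word fixes the first of them exactly when the denominator q is
    even.  Then the other two states are fixed too if x is even, and the reversed
    word has the same writhe; if y is even they are exchanged, and it is the
    reversed and flipped word that has the opposite writhe.  Hence the three
    cases of the class, each of which is stable under reversal and exchange of
    letters ([word_class_rev], [word_class_flip]).

    It remains to see that the frieze determines the word up to these
    operations.  Its entries belong to the chords of a polygon with m + 3
    vertices, where m is the number of interior rows; the zigzag of ones is a
    triangulation by nested chords.  All vertices but the two ears have quiddity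
    at least 2 ([chord_path_quiddity]), so another zigzag of ones starts at one
    of the two ears, and a zigzag is determined by its start because two adjacent
    ones in a row would force a zero.  The two ears are exchanged by the glide
    symmetry ([glide]), which reverses the word and exchanges the letters, as do
    the reflections of the frieze separately ([is_Gamma_equiv]). *)

Set Implicit Arguments.
Unset Strict Implicit.
Unset Printing Implicit Defensive.
Import Order.TTheory GRing.Theory Num.Theory.
Local Open Scope ring_scope.
Local Open Scope quotient_scope.

(** * Words and Farey parents *)

Definition flip (l : letter) : letter := if l is L then R else L.

Lemma flipK : involutive flip. Proof. by case. Qed.

(** The parents x/s and y/r of the fraction with word w, as (x, s, y, r): the first
    letter replaces one parent of the fraction of the rest by that fraction. *)
Fixpoint farey (w : seq letter) : int * int * int * int :=
  if w is l :: w' then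
    let: (x, s, y, r) := farey w' in
    if l is L then (x, s, x + y, s + r) else (x + y, s + r, y, r)
  else (0, 1, 1, 1).

Definition rat_of_word (w : seq letter) : rat :=
  let: (x, s, y, r) := farey w in (x + y)%:~R / (s + r)%:~R.

Lemma fareyP w : let: (x, s, y, r) := farey w in
  [/\ 0 <= x < s, 0 < y <= r, 0 < s & 0 < r] /\ s * y - x * r = 1.
Proof.
elim: w => [|l w] //=.
case: (farey w) => [[[x s] y] r] [[x0 y0 s0 r0] det].
by case: l; split; try split; try lia.
Qed.

Lemma farey_flip w : let: (x, s, y, r) := farey w in
  farey (map flip w) = (r - y, r, s - x, s).
Proof.
elim: w => [|l w] //=.
case: (farey w) => [[[x s] y] r] -> /=.
by case: l => /=; congr (_, _, _, _); ring.
Qed.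

Lemma coprime_frac (a b c d : int) : 0 < b -> 0 < d ->
  coprimez a b -> coprimez c d ->
  a%:~R / b%:~R = c%:~R / d%:~R :> rat -> a = c /\ b = d.
Proof.
move=> b0 d0 cab ccd E.
have n1 := coprimeq_num cab; have n2 := coprimeq_num ccd.
have d1 := coprimeq_den cab; have d2 := coprimeq_den ccd.
rewrite E n2 !gtr0_sg // !mul1r in n1.
by rewrite E d2 !gt_eqF ?gtr0_norm // in d1; rewrite n1 d1.
Qed.

Lemma det_coprime (a b c d : int) : b * c - a * d = 1 ->
  coprimez c d /\ coprimez (a + c) (b + d).
Proof.
move=> E; split; apply/coprimezP.
  by exists (b, - a); rewrite /= -E; ring.
by exists (b, - a); rewrite /= -E; ring.
Qed.

(** Two solutions differ by a multiple of (c, d), which is coprime, so that at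
    most one of them satisfies 0 <= b < d. *)
Lemma parent_unique (a b a' b' c d : int) :
  b * c - a * d = 1 -> b' * c - a' * d = 1 -> 0 <= b -> b < d -> 0 <= b' -> b' < d ->
  a = a' /\ b = b'.
Proof.
move=> E E' b0 bd b0' bd'.
have [ccd _] := det_coprime E.
have Ed : (b - b') * c = (a - a') * d by lia.
have : (d %| (b - b'))%Z.
  rewrite -(@Gauss_dvdzl _ _ c); first by rewrite Ed dvdz_mull.
  by rewrite coprimez_sym.
case/dvdzP => k Ek.
have k0 : k = 0 by nia.
have Eb : b = b' by move: Ek; rewrite k0; lia.
split => //; subst b'.
have : (a - a') * d = 0 by rewrite -Ed subrr mul0r.
move/eqP; rewrite mulf_eq0 subr_eq0 => /orP[/eqP //|/eqP]; lia.
Qed.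

(** Going from the larger parent c/d back to alpha, the other parent is determined
    by the determinant, so it is the one that the recursion of [farey] keeps. *)
Lemma word_rat_of_word alpha w : word alpha w -> alpha = rat_of_word w.
Proof.
elim => {alpha w} [|alpha a b c d w _ [[b0 d0 det] ->] lt _ IH
                   |alpha a b c d w _ [[b0 d0 det] ->] lt _ IH].
- by [].
- move: IH; rewrite /rat_of_word /=; have := fareyP w.
  case: (farey w) => [[[x s] y] r] [[x0 y0 s0 r0] det'] IH.
  have [ccd _] := det_coprime det; have [_ ccd'] := det_coprime det'.
  have [||E1 E2] := coprime_frac _ _ ccd ccd' IH; [lia|lia|].
  subst c d.
  have det'' : s * (x + y) - x * (s + r) = 1 by rewrite -det'; ring.
  by have [||||-> ->] := parent_unique det det''; try lia.
- move: IH; rewrite /rat_of_word /=; have := fareyP w.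
  case: (farey w) => [[[x s] y] r] [[x0 y0 s0 r0] det'] IH.
  have det1 : (- d) * a - (- c) * b = 1 by rewrite -det; ring.
  have [ccd _] := det_coprime det1; have [_ ccd'] := det_coprime det'.
  have [||E1 E2] := coprime_frac _ _ ccd ccd' IH; [lia|lia|].
  subst a b.
  have dets : (s + r - d) * (x + y) - (x + y - c) * (s + r) = 1 by rewrite -det; ring.
  have det'' : s * (x + y) - x * (s + r) = 1 by rewrite -det'; ring.
  have d1 : d != 0.
    apply/eqP => dE; move: det; rewrite dE mulr0 subr0.
    by have [] := ltrP 0 c; nia.
  have [||||E3 E4] := parent_unique dets det''; try lia.
  have -> : c = y by move: E3; lia.
  by have -> : d = r by move: E4; lia.
Qed.

Lemma rat_of_word_gt0_lt1 w : 0 < rat_of_word w < 1.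
Proof.
rewrite /rat_of_word; have := fareyP w.
case: (farey w) => [[[x s] y] r] [[x0 y0 s0 r0] det].
have p0 : 0 < (x + y)%:~R :> rat by rewrite ltr0z; lia.
have q0 : 0 < (s + r)%:~R :> rat by rewrite ltr0z; lia.
by rewrite divr_gt0 //= ltr_pdivrMr // mul1r ltr_int; lia.
Qed.

Lemma parents_rat_of_word w : let: (x, s, y, r) := farey w in parents (rat_of_word w) x s y r.
Proof.
rewrite /rat_of_word; have := fareyP w.
case: (farey w) => [[[x s] y] r] [[x0 y0 s0 r0] det].
by split=> //; split=> //; lia.
Qed.

(** The denominator of the fraction of a word is at least 2, which excludes the
    second pair of parents that an integer has. *)
Lemma parents_unique w x s y r :
  parents (rat_of_word w) x s y r -> farey w = (x, s, y, r).
Proof.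
rewrite /rat_of_word; have := fareyP w.
case: (farey w) => [[[x' s'] y'] r'] [[x0 y0 s0 r0] det] [[s1 r1 det1] E].
have [_ c] := det_coprime det; have [_ c1] := det_coprime det1.
have q0 : 0 < s + r.
  have [//|h] := ltrP 0 (s + r).
  have s00 : s = 0 by lia.
  have r00 : r = 0 by lia.
  by move: det1; rewrite s00 r00 mul0r mulr0.
have [||E1 E2] := coprime_frac _ _ c c1 E; [lia | by [] |].
have dets : s * (x' + y') - x * (s' + r') = 1 by rewrite E1 E2 -det1; ring.
have det'' : s' * (x' + y') - x' * (s' + r') = 1 by rewrite -det; ring.
have s2 : s < s' + r'.
  have [//|] := ltrP s (s' + r') => h.
  have r00 : r = 0 by lia.
  have ss : s = s' + r' by lia.
  by move: det1; rewrite r00 mulr0 subr0; have [] := ltrP 0 y; nia.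
have [||||E3 E4] := parent_unique det'' dets; try lia.
by congr (_, _, _, _); lia.
Qed.

Lemma denq_rat_of_word w : denq (rat_of_word w) = let: (x, s, y, r) := farey w in s + r.
Proof.
rewrite /rat_of_word; have := fareyP w.
case: (farey w) => [[[x' s'] y'] r'] [[x0 y0 s0 r0] det].
have [_ c] := det_coprime det.
rewrite (coprimeq_den c) gt_eqF; last lia.
by rewrite gtr0_norm //; lia.
Qed.

Lemma numq_rat_of_word w : numq (rat_of_word w) = let: (x, s, y, r) := farey w in x + y.
Proof.
rewrite /rat_of_word; have := fareyP w.
case: (farey w) => [[[x' s'] y'] r'] [[x0 y0 s0 r0] det].
have [_ c] := det_coprime det.
by rewrite (coprimeq_num c) gtr0_sg ?mul1r //; lia.
Qed.

Lemma irat_rat_of_word w : irat (rat_of_word w) = rat_of_word (map flip w).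
Proof.
rewrite /irat denq_rat_of_word numq_rat_of_word /rat_of_word; have := farey_flip w.
case: (farey w) => [[[x s] y] r] ->.
by congr (_%:~R / _%:~R); ring.
Qed.

Lemma rat_of_wordP w : word (rat_of_word w) w.
Proof.
elim: w => [|l w IH]; first exact: word_half.
have := fareyP (l :: w); have := fareyP w; have := parents_rat_of_word (l :: w).
have := numq_rat_of_word (l :: w); have := denq_rat_of_word (l :: w).
have half : numq (1 / 2%:R) = 1 /\ denq (1 / 2%:R) = 2 by [].
move: IH; rewrite {1}/rat_of_word /=.
case: (farey w) => [[[x s] y] r] IH.
case: l => Ed En P [[x0 y0 s0 r0] det] [_ det'].
- apply: (word_L _ P) => //; last lia.
  apply/eqP => E; move: Ed En; rewrite E half.1 half.2; lia.
- apply: (word_R _ P) => //; last lia.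
  apply/eqP => E; move: Ed En; rewrite E half.1 half.2; lia.
Qed.

(** * Rational tangles as words of crossings *)

Definition add_cross (S : tangle) (l : letter) : tangle :=
  if l is L then vsum S cross else hsum S cross.

Definition word_tangle (w : seq letter) : tangle := foldl add_cross cross w.

(** Equality up to the order in which the arcs are listed; the diagram of a tangle
    is used only through the set of its arcs. *)
Record tangle_eq (S S' : tangle) : Prop := TangleEq {
  tangle_eq_cross : tcross S = tcross S';
  tangle_eq_joins : tjoins S =i tjoins S';
  tangle_eq_end : tend S =1 tend S' }.

Lemma tangle_eq_trans S2 S1 S3 :
  tangle_eq S1 S2 -> tangle_eq S2 S3 -> tangle_eq S1 S3.
Proof.
case=> c1 j1 e1 [c2 j2 e2]; split; first by rewrite c1.
  by move=> x; rewrite j1.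
by move=> x; rewrite e1.
Qed.

Lemma sum_at_eq k S S' U : tangle_eq S S' ->
  tangle_eq (sum_at k S U) (sum_at k S' U).
Proof.
case=> cE jE eE; rewrite /sum_at; case: odd; split => //=.
all: rewrite /juxt_joins ?cE // => x; rewrite ?eE //.
all: by rewrite !inE !mem_cat jE.
Qed.

Lemma shift_endD m n x : shift_end (m + n) x = shift_end m (shift_end n x).
Proof. by rewrite /shift_end /= addnA. Qed.

Definition shift_arc (n : nat) (e : endpoint * endpoint) :=
  (shift_end n e.1, shift_end n e.2).

Lemma juxt_joinsE S U :
  juxt_joins S U = tjoins S ++ map (shift_arc (tcross S)) (tjoins U).
Proof. by []. Qed.

Lemma map_shiftD m n s :
  map (shift_arc m) (map (shift_arc n) s) = map (shift_arc (m + n)) s.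
Proof.
by rewrite -map_comp; apply: eq_map => e; rewrite /shift_arc /= !shift_endD.
Qed.

(** Crossings are numbered from left to right or from top to bottom, so that no
    renumbering is needed: only the lists of arcs differ by their order. *)
Lemma sum_at_assoc k S U V' : tangle_eq (sum_at k S (sum_at k U V'))
  (sum_at k (sum_at k S U) V').
Proof.
rewrite /sum_at; case: odd; split=> //=; rewrite ?addnA //;
  try by move=> [[] []] //=; rewrite shift_endD.
all: move=> x; rewrite !juxt_joinsE /= !juxt_joinsE map_cat map_shiftD !shift_endD.
all: rewrite !(inE, mem_cat) /= /shift_arc /=.
all: set m1 := _ \in tjoins S; set m2 := _ \in map _ _; set m3 := _ \in map _ _.
all: by rewrite -!orbA; do 4 case: (x == _); case: m1; case: m2; case: m3.
Qed.

Definition letter_at (k : nat) : letter := if odd k then L else R.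

Lemma add_cross_at S k : add_cross S (letter_at k) = sum_at k S cross.
Proof. by rewrite /letter_at /sum_at; case: odd. Qed.

(** The letters that add the crossings of a rational tangle one at a time, starting
    from the innermost crossing, which accounts for the predecessor. *)
Fixpoint cf_word (k : nat) (s : seq nat) : seq letter :=
  match s with
  | [::] => [::]
  | [:: a] => nseq a.-1 (letter_at k)
  | a :: s' => cf_word k.+1 s' ++ nseq a (letter_at k)
  end.

Lemma foldl_nseq S k a :
  foldl add_cross S (nseq a (letter_at k)) = iter a (fun U => sum_at k U cross) S.
Proof.
by elim: a S => //= a IH S; rewrite IH add_cross_at -iterSr.
Qed.

Lemma sum_twist S k a : (0 < a)%N ->
  tangle_eq (sum_at k S (twist k a)) (iter a (fun U => sum_at k U cross) S).
Proof.
case: a => // a _; elim: a => [|a IH]; first by [].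
rewrite iterS.
have -> : twist k a.+2 = sum_at k (twist k a.+1) cross by [].
exact: tangle_eq_trans (sum_at_assoc _ _ _ _) (sum_at_eq _ _ IH).
Qed.

Lemma rational_tangle_cf_word k s : s != [::] -> all (leq 1) s ->
  tangle_eq (rational_tangle k s) (word_tangle (cf_word k s)).
Proof.
elim: s k => //= a [|b s] IH k _ /andP[a0 pos].
  by rewrite /word_tangle foldl_nseq.
rewrite /word_tangle foldl_cat foldl_nseq.
apply: tangle_eq_trans (sum_twist _ _ a0) _.
have {}IH := IH k.+1 isT pos.
elim: a {a0} => [|a IHa]; first exact: IH.
by rewrite !iterS; apply: sum_at_eq.
Qed.

(** The effect of one more crossing on the fraction of a tangle. *)
Definition moebius (t : rat) (l : letter) : rat := if l is L then t / (1 + t) else t + 1.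

Definition wvalue (w : seq letter) : rat := foldl moebius 1 w.

Lemma wvalue_rcons w l : wvalue (rcons w l) = moebius (wvalue w) l.
Proof. by rewrite /wvalue -cats1 foldl_cat. Qed.

Lemma wvalue_gt0 w : 0 < wvalue w.
Proof.
elim/last_ind: w => // w l IH; rewrite wvalue_rcons.
by case: l => /=; rewrite ?divr_gt0 ?addr_gt0.
Qed.

Lemma moebius_neq1 (t : rat) l : 0 < t -> moebius t l != 1.
Proof.
move=> t0; case: l => /=; last by lra.
have t1 : 1 + t != 0 by lra.
apply/eqP => /(congr1 (fun z => z * (1 + t))); rewrite divfK //; lra.
Qed.

Lemma moebiusL_lt1 (t : rat) : 0 < t -> moebius t L < 1.
Proof. by move=> t0; rewrite ltr_pdivrMr; lra. Qed.

Lemma moebius_inj (t u : rat) l m :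
  0 < t -> 0 < u -> moebius t l = moebius u m -> t = u /\ l = m.
Proof.
move=> t0 u0; have := moebiusL_lt1 t0; have := moebiusL_lt1 u0.
case: l m => [] [] /= h1 h2 E; try (exfalso; lra).
- split => //.
  have d1 : 1 + t != 0 by lra.
  have d2 : 1 + u != 0 by lra.
  by move/eqP: E; rewrite eqr_div // => /eqP; lra.
- by split; first lra.
Qed.

(** The last letter is L or R according to whether the value is below or above 1;
    this is the descent of the Stern-Brocot tree. *)
Lemma wvalue_inj : injective wvalue.
Proof.
elim/last_ind => [|w l IH] v; case/lastP: v => [|v m] //.
- by rewrite wvalue_rcons => /esym/eqP; rewrite (negPf (moebius_neq1 _ (wvalue_gt0 _))).
- by rewrite wvalue_rcons => /eqP; rewrite (negPf (moebius_neq1 _ (wvalue_gt0 _))).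
- rewrite !wvalue_rcons => E.
  by have [/IH -> ->] := moebius_inj (wvalue_gt0 _) (wvalue_gt0 _) E.
Qed.

(** The first letter acts on t by the Moebius transformation whose matrix
    multiplies the matrix of parents on the right. *)
Lemma foldl_moebius_farey w (t : rat) : 0 < t ->
  foldl moebius t (rcons w L) = let: (x, s, y, r) := farey w in
  (x%:~R + y%:~R * t) / (s%:~R + r%:~R * t).
Proof.
elim: w t => [|l w IH] t t0 /=; first by congr (_ / _); ring.
rewrite IH; last by case: l; rewrite /= ?divr_gt0 ?addr_gt0.
have := fareyP w; case: (farey w) => [[[x s] y] r] [[x0 y0 s0 r0] _].
have s0' : 0 < s%:~R :> rat by rewrite ltr0z.
have r0' : 0 < r%:~R :> rat by rewrite ltr0z.
have t1 : 1 + t != 0 by lra.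
have m0 : 0 < r%:~R * t by rewrite mulr_gt0.
have m1 : 0 < s%:~R * t by rewrite mulr_gt0.
case: l => /=; rewrite !intrD.
- by field; rewrite t1 andbT mulrDl; lra.
- by congr (_ / _); ring.
Qed.

Lemma wvalue_rat_of_word w : wvalue (rcons w L) = rat_of_word w.
Proof.
rewrite /wvalue foldl_moebius_farey // /rat_of_word.
by case: (farey w) => [[[x s] y] r]; rewrite !mulr1 !intrD.
Qed.

Lemma foldl_moebius_nseq (t : rat) k a : 0 < t ->
  foldl moebius t (nseq a (letter_at k)) =
  if odd k then (a%:R + t^-1)^-1 else a%:R + t.
Proof.
rewrite /letter_at; elim: a t => [|a IH] t t0 /=.
  by case: odd; rewrite !add0r ?invrK.
rewrite IH; last by case: odd; rewrite /= ?divr_gt0 ?addr_gt0.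
case: odd => /=; last by rewrite -addn1 natrD; ring.
have t1 : 1 + t != 0 by lra.
congr (_ ^-1); rewrite invf_div mulrDl mulfV; last lra.
by rewrite -addn1 natrD; ring.
Qed.

Lemma wvalue_cf_word k s : s != [::] -> all (leq 1) s ->
  wvalue (cf_word k s) =
  if odd k then cfrac_value s else (cfrac_value s)^-1.
Proof.
elim: s k => //= a [|b s] IH k _ /andP[a0 pos].
  rewrite /wvalue foldl_moebius_nseq // invr1 natr1 prednK // addr0.
  by case: odd => //; rewrite invrK.
rewrite /wvalue foldl_cat -/(wvalue _) foldl_moebius_nseq ?wvalue_gt0 //.
rewrite (IH k.+1 isT pos) /= invrK.
by case: odd => /=; rewrite ?invrK.
Qed.

(** The word of alpha, read from the left, goes up from alpha to 1/2 in the tree,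
    while its tangle is built from the inside; both lists of letters have the value
    alpha, hence agree.  The last L is the step from 1/1 to 1/2. *)
Lemma T_rat_of_word w : tangle_eq (T (rat_of_word w)) (word_tangle (rcons w L)).
Proof.
have h := rat_of_word_gt0_lt1 w; have [cv pos] := cfracK h.
have s0 : cfrac (rat_of_word w) != [::].
  by apply/eqP => E; move: cv h; rewrite E /= => <-.
have -> : rcons w L = cf_word 1 (cfrac (rat_of_word w)).
  by apply: wvalue_inj; rewrite wvalue_rat_of_word wvalue_cf_word.
exact: rational_tangle_cf_word.
Qed.

(** * Circles of a resolved diagram *)

(** A retraction that respects connectedness in both directions matches the
    components; the closed set a selects those that are to be counted. *)
Lemma n_comp_retract (T T' : finType) (e : rel T) (e' : rel T') (a : pred T)
    (h : T' -> T) (rho : T -> T') :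
  connect_sym e -> connect_sym e' -> closed e a ->
  (forall x', h x' \in a) -> cancel h rho ->
  (forall x, x \in a -> connect e x (h (rho x))) ->
  (forall x y, x \in a -> e x y -> connect e' (rho x) (rho y)) ->
  (forall x' y', e' x' y' -> connect e (h x') (h y')) ->
  n_comp e a = n_comp e' predT.
Proof.
move=> se se' cl ha hK hrho re hr.
rewrite (adjunction_n_comp h se se' cl).
  by apply: eq_n_comp_r => x'; rewrite !inE; apply: ha.
apply: (intro_adjunction se' cl (fun x _ => rho x)) => [x xa | x' _].
  by split=> [|y _ exy]; [apply: hrho | apply: re].
by rewrite hK; split=> // y'; apply: hr.
Qed.

Lemma n_comp_pred0 (T : finType) : n_comp (fun _ _ : T => false) predT = #|T|.
Proof.
apply: eq_card => x; rewrite !inE andbT; apply/eqP.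
have /connectP[p] := connect_root (fun _ _ : T => false) x.
by case: p.
Qed.

Definition arc_rel (n : nat) (arcs : seq (endpoint * endpoint)) :
    rel ('I_n * corner) :=
  [rel x y | ((pt x, pt y) \in arcs) || ((pt y, pt x) \in arcs)].

Lemma circlesE n arcs : circles n arcs = n_comp (@arc_rel n arcs) predT.
Proof. by []. Qed.

Lemma arc_rel_sym n arcs : connect_sym (@arc_rel n arcs).
Proof. by apply: sym_connect_sym => x y; rewrite /arc_rel /= orbC. Qed.

Lemma eq_circles n arcs arcs' : arcs =i arcs' -> circles n arcs = circles n arcs'.
Proof.
move=> E; apply: eq_n_comp => x y; apply: eq_connect => {}x {}y.
by rewrite /= !E.
Qed.

(** Connectedness along arcs for endpoints with arbitrary crossing numbers, which
    spares the bounds of the ordinals when one exhibits paths. *)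
Inductive linked (arcs : seq (endpoint * endpoint)) : endpoint -> endpoint -> Prop :=
| linked_refl x : linked arcs x x
| linked_arc x y : (x, y) \in arcs -> linked arcs x y
| linked_sym x y : linked arcs x y -> linked arcs y x
| linked_trans y x z : linked arcs x y -> linked arcs y z -> linked arcs x z.

Lemma linked_sub arcs arcs' : (forall e, e \in arcs -> linked arcs' e.1 e.2) ->
  forall x y, linked arcs x y -> linked arcs' x y.
Proof.
move=> sub x y; elim=> {x y} [x|x y /sub //|x y _ IH|y x z _ IH1 _ IH2].
- exact: linked_refl.
- exact: linked_sym.
- exact: linked_trans IH1 IH2.
Qed.

Definition arcs_below (n : nat) (arcs : seq (endpoint * endpoint)) : bool :=
  all (fun e => (e.1.1 < n) && (e.2.1 < n))%N arcs.

Lemma pt_inj n : injective (@pt n).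
Proof. by move=> [i c] [j d] [/val_inj -> ->]. Qed.

(** A path between two corners stays among the corners of the diagram, because all
    of its arcs do. *)
Lemma linked_connect n arcs x y : arcs_below n arcs ->
  linked arcs (pt x) (pt y) -> connect (@arc_rel n arcs) x y.
Proof.
move=> below; have lift (a : endpoint) : (a.1 < n)%N -> {x : 'I_n * corner | pt x = a}.
  by case: a => i c /= lt; exists (Ordinal lt, c).
move Ea: (pt x) => a; move Eb: (pt y) => b l.
(* For a trivial path nothing guarantees that the endpoints are corners. *)
have [E|[x' [y' [Ex Ey]]]] : a = b \/ exists x y : 'I_n * corner,
    [/\ pt x = a, pt y = b & connect (@arc_rel n arcs) x y]; last 2 first.
- by move: Ea Eb; rewrite E => <- /pt_inj ->.
- by move: Ex Ey; rewrite -Ea -Eb => /pt_inj -> /pt_inj ->.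
elim: l => {a b x y Ea Eb} [a|a b ab|a b _ IH|b a c _ IH1 _ IH2].
- by left.
- have /allP /(_ _ ab) /andP[/lift[x Ex] /lift[y Ey]] := below.
  right; exists x, y; split => //; apply: connect1.
  by rewrite /arc_rel /= Ex Ey ab.
- case: IH => [->|[x [y [Ex Ey xy]]]]; [by left | right].
  by exists y, x; rewrite arc_rel_sym.
- case: IH1 => [-> //|[x [y [Ex Ey xy]]]].
  case: IH2 => [<-|[x' [y' [Ex' Ey' xy']]]]; first by right; exists x, y.
  right; exists x, y'; split=> //; apply: connect_trans xy _.
  by move: Ex'; rewrite -Ey => /pt_inj <-.
Qed.

(** Forgetting the last crossing of a resolved diagram: rho slides each of its
    corners along the arcs to a corner of another crossing, except for the corners
    in loop, which form a circle of their own. *)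
Lemma circles_contract n arcs arcs' (rho : corner -> endpoint) (loop : pred corner)
    (R := fun x : endpoint => if x.1 == n.+1 then rho x.2 else x)
    (lp := fun x : endpoint => (x.1 == n.+1) && loop x.2) :
  arcs_below n.+2 arcs -> arcs_below n.+1 arcs' ->
  (forall c, ~~ loop c -> ((rho c).1 < n.+1)%N /\ linked arcs (n.+1, c) (rho c)) ->
  (forall e, e \in arcs -> lp e.1 = lp e.2) ->
  (forall e, e \in arcs -> ~~ lp e.1 -> linked arcs' (R e.1) (R e.2)) ->
  (forall e, e \in arcs' -> linked arcs e.1 e.2) ->
  (forall c d, loop c -> loop d -> linked arcs (n.+1, c) (n.+1, d)) ->
  circles n.+2 arcs = ([exists c, loop c] + circles n.+1 arcs')%N.
Proof.
move=> below below' rhoP lpE RP arcsP loopP.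
rewrite !circlesE.
set e := @arc_rel _ arcs; set e' := @arc_rel _ arcs'.
(* The corners outside the circle that comes off. *)
pose a : pred ('I_n.+2 * corner) := fun x => ~~ lp (pt x).
have se : connect_sym e by apply: arc_rel_sym.
have se' : connect_sym e' by apply: arc_rel_sym.
have cl : closed e a.
  by move=> x y exy; rewrite !unfold_in /a; case/orP: exy => /lpE /= ->.
pose h (x : 'I_n.+1 * corner) : 'I_n.+2 * corner := (widen_ord (leqnSn _) x.1, x.2).
pose r (x : 'I_n.+2 * corner) : 'I_n.+1 * corner :=
  (inord (R (pt x)).1, (R (pt x)).2).
have pth x : pt (h x) = pt x by [].
have ltn (x : 'I_n.+1 * corner) : ((pt x).1 == n.+1) = false.
  by rewrite /= ltn_eqF.
have ptr x : x \in a -> pt (r x) = R (pt x).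
  move=> xa; have lt : ((R (pt x)).1 < n.+1)%N.
    move: xa; rewrite unfold_in /a /lp /R; have [/= E nl|ne _] := eqVneq (pt x).1 n.+1.
      by case: (rhoP _ nl).
    by rewrite ltn_neqAle ne -ltnS ltn_ord.
  by rewrite {1}/pt /r /= inordK //; case: (R _).
have ha x : h x \in a by rewrite unfold_in /a /lp pth ltn.
have hR (x : 'I_n.+2 * corner) : x \in a -> linked arcs (pt x) (R (pt x)).
  rewrite unfold_in /a /lp /R /pt /=; have [-> nl|ne _] := eqVneq (x.1 : nat) n.+1.
    by case: (rhoP _ nl).
  exact: linked_refl.
rewrite (n_compC a) addnC; congr (_ + _)%N; last first.
  apply: (n_comp_retract (h := h) (rho := r)) => //.
  - move=> x; apply: (@pt_inj n.+1); rewrite ptr ?ha // pth /R.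
    by rewrite ltn.
  - move=> x xa; apply: linked_connect => //; rewrite pth ptr //.
    exact: hR.
  - move=> x y xa exy; have ya : y \in a by rewrite -(cl _ _ exy).
    apply: linked_connect => //; rewrite !ptr //.
    by case/orP: exy => E; [|apply: linked_sym]; apply: (RP _ E).
  - move=> x y exy; apply: linked_connect => //; rewrite !pth.
    by case/orP: exy => E; [|apply: linked_sym]; apply: (arcsP _ E).
case: existsP => [[c lc]|noloop].
  pose x0 : 'I_n.+2 * corner := (ord_max, c).
  rewrite -[RHS]/1%N -(n_comp_connect se x0); apply: eq_n_comp_r => y.
  have lpx : lp (pt x0) by rewrite /lp /= eqxx.
  apply/idP/idP => /=; rewrite !unfold_in /a negbK => yP.
    apply: linked_connect => //; case: y yP => [i d] /andP[/= /eqP E ld].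
    by have := loopP _ _ lc ld; rewrite /pt /= E.
  have := closed_connect cl yP; rewrite !unfold_in /a lpx.
  by case: (lp _).
apply: eq_card0 => y; rewrite !inE; apply/negbTE/andP => [[_]]; rewrite unfold_in /a.
by rewrite negbK /lp => /andP[_ ly]; apply: noloop; exists (pt y).2.
Qed.

(** * Contracting a crossing in the bracket *)

(* The value of a circle. *)
Local Notation delta := (- A ^+ 2 - A ^- 2).

Lemma circles_gt0 n arcs : (0 < circles n.+1 arcs)%N.
Proof.
rewrite circlesE; apply/card_gt0P.
exists (fingraph.root (@arc_rel n.+1 arcs) (ord0, NW)); rewrite !inE andbT.
exact/roots_root/arc_rel_sym.
Qed.

Lemma eq_bracket n j arcs arcs' : arcs =i arcs' ->
  bracket_rec n j arcs = bracket_rec n j arcs'.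
Proof.
elim: j arcs arcs' => [|j IH] arcs arcs' E /=; first by rewrite (eq_circles _ E).
by congr (_ * _ + _ * _); apply: IH => x; rewrite !inE E.
Qed.

Lemma bracket_recS n j arcs : bracket_rec n j.+1 arcs =
  A * bracket_rec n j (smoothA j ++ arcs) + A^-1 * bracket_rec n j (smoothB j ++ arcs).
Proof. by []. Qed.

Lemma arcs_below_cat n s t : arcs_below n (s ++ t) = arcs_below n s && arcs_below n t.
Proof. exact: all_cat. Qed.

Lemma arcs_below_sub m n s : (m <= n)%N -> arcs_below m s -> arcs_below n s.
Proof.
move=> le; apply: sub_all => e /andP[h1 h2].
by rewrite (leq_trans h1) // (leq_trans h2).
Qed.

Lemma linked_catl s t x y : linked s x y -> linked (s ++ t) x y.
Proof.
by apply: linked_sub => -[a b] h; apply: linked_arc; rewrite mem_cat h.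
Qed.

Lemma linked_catr s t x y : linked t x y -> linked (s ++ t) x y.
Proof.
by apply: linked_sub => -[a b] h; apply: linked_arc; rewrite mem_cat h orbT.
Qed.

(** The remaining crossings are resolved in the same way on both sides, so the
    contraction of circles passes to the state sum, where a circle that came off
    contributes one factor delta.  There is a crossing left, hence a circle left,
    so that no truncation occurs in the exponent of delta. *)
Lemma bracket_contract n extra extra' rest (rho : corner -> endpoint) (loop : pred corner)
    (R := fun x : endpoint => if x.1 == n.+1 then rho x.2 else x)
    (lp := fun x : endpoint => (x.1 == n.+1) && loop x.2) :
  arcs_below n.+2 extra -> arcs_below n.+1 extra' -> arcs_below n.+1 rest ->
  (forall c, ~~ loop c -> ((rho c).1 < n.+1)%N /\ linked extra (n.+1, c) (rho c)) ->
  (forall e, e \in extra -> lp e.1 = lp e.2) ->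
  (forall e, e \in extra -> ~~ lp e.1 -> linked extra' (R e.1) (R e.2)) ->
  (forall e, e \in extra' -> linked extra e.1 e.2) ->
  (forall c d, loop c -> loop d -> linked extra (n.+1, c) (n.+1, d)) ->
  forall j, (j <= n.+1)%N ->
  bracket_rec n.+2 j (extra ++ rest) =
  delta ^+ [exists c, loop c] * bracket_rec n.+1 j (extra' ++ rest).
Proof.
move=> be be' br rhoP lpE RP exP loopP j; elim: j rest br => [|j IH] rest br le.
  have old e : e \in rest ->
      [/\ lp e.1 = false, lp e.2 = false, R e.1 = e.1 & R e.2 = e.2].
    move=> er; have /andP[h1 h2] := allP br _ er.
    by rewrite /lp /R !ltn_eqF.
  rewrite /= (@circles_contract n _ (extra' ++ rest) rho loop) //.
  - have := circles_gt0 n (extra' ++ rest); case: (circles _ _) => // c _.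
    by rewrite addnS /= exprD.
  - by rewrite arcs_below_cat be (arcs_below_sub _ br).
  - by rewrite arcs_below_cat be'.
  - by move=> c /rhoP[h1 h2]; split => //; apply: linked_catl.
  - move=> e; rewrite mem_cat => /orP[/lpE //|/old[h1 h2 _ _]].
    by move: h1 h2; rewrite /lp => -> ->.
  - move=> e; rewrite mem_cat => /orP[eE nl|er _].
      by apply: linked_catl; apply: RP.
    have [_ _ h1 h2] := old e er; rewrite -/(R e.1) -/(R e.2) h1 h2.
    by apply: linked_catr; apply: linked_arc; case: (e) er.
  - move=> e; rewrite mem_cat => /orP[/exP|er]; first exact: linked_catl.
    by apply: linked_catr; apply: linked_arc; case: (e) er.
  - by move=> c d lc ld; apply: linked_catl; apply: loopP.
have perm (s : seq (endpoint * endpoint)) t :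
    s ++ t ++ rest =i t ++ s ++ rest.
  by move=> x; rewrite !mem_cat orbCA.
rewrite !bracket_recS !(eq_bracket _ _ (perm _ extra)) !(eq_bracket _ _ (perm _ extra')).
have below_sm s : s = smoothA j \/ s = smoothB j -> arcs_below n.+1 (s ++ rest).
  by move=> h; rewrite arcs_below_cat br andbT; case: h => ->; rewrite /arcs_below /= le.
rewrite (IH _ (below_sm _ (or_introl erefl)) (ltnW le)).
rewrite (IH _ (below_sm _ (or_intror erefl)) (ltnW le)).
by rewrite mulrDr; congr (_ + _); rewrite mulrCA.
Qed.

Record tangle_ok (S : tangle) : Prop := TangleOk {
  tangle_ok_cross : (0 < tcross S)%N;
  tangle_ok_joins : arcs_below (tcross S) (tjoins S);
  tangle_ok_end : forall c, ((tend S c).1 < tcross S)%N }.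

Lemma word_tangle_ok w : tangle_ok (word_tangle w).
Proof.
elim/last_ind: w => [|w l]; first by split.
rewrite /word_tangle -cats1 foldl_cat /= -/(word_tangle w) => -[c j e].
have sub : forall k, (k < tcross (word_tangle w) -> k < tcross (word_tangle w) + 1)%N.
  by move=> k; rewrite addn1 ltnS => /ltnW.
case: l; split => /=; rewrite ?addn1 // /juxt_joins ?cats0;
  rewrite ?addn0 ?ltnS ?leqnn ?(arcs_below_sub _ j) ?(ltnW (e _)) //=.
all: by move=> [[] []] /=; rewrite ?addn0 ?ltnS ?leqnn ?(ltnW (e _)).
Qed.

(** The numerator closure; D is the denominator closure. *)
Definition numer_closure (S : tangle) : diagram :=
  Diagram (tcross S)
    ((tend S NW, tend S NE) :: (tend S SW, tend S SE) :: tjoins S).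

(** * Both closures of a tangle with one more crossing *)

Ltac link_arc := by apply: linked_arc; rewrite !inE ?eqxx ?orbT.

(** Proves [linked] by following at most k arcs of an explicit list. *)
Ltac link k :=
  first
    [ exact: linked_refl
    | lazymatch k with S ?k' =>
        multimatch goal with
        | |- linked ?s ?a _ =>
            multimatch s with
            | context [(a, ?y)] =>
                apply: (@linked_trans _ y); [link_arc | link k']
            | context [(?y, a)] =>
                apply: (@linked_trans _ y); [apply: linked_sym; link_arc | link k']
            end
        end
      end ].

Ltac each_arc ne :=
  let e := fresh "e" in
  move=> e; rewrite !inE; do ?[case/orP]; move/eqP->; rewrite /= ?ne ?eqxx //=;
  try (move=> _); link 6%N.

Lemma bracket_last n a b c d js : bracket_rec n.+2 n.+2 [:: a, b, c, d & js] =
  A * bracket_rec n.+2 n.+1 ((smoothA n.+1 ++ [:: a; b; c; d]) ++ js) +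
  A^-1 * bracket_rec n.+2 n.+1 ((smoothB n.+1 ++ [:: a; b; c; d]) ++ js).
Proof. by []. Qed.

Ltac corners := rewrite /smoothA /smoothB /NW /NE /SW /SE /=.

(** Applies [bracket_contract] to explicit arcs: extra' are the arcs after
    contraction, rho and loop are as there, and ne says that the ends of the tangle
    do not belong to the new crossing. *)
Ltac contract e ne extra' rho loop :=
  rewrite (@bracket_contract _ _ extra' _ rho loop);
  [ corners
  | by corners; rewrite /arcs_below /= !(leqW (e _)) ?ltnSn
  | by corners; rewrite /arcs_below /= !e
  | by []
  | by corners; move=> [[] []] //= _; (split; [by [] | link 6%N])
  | corners; each_arc ne
  | corners; each_arc ne
  | corners; each_arc ne
  | by corners; move=> [[] []] [[] []] //= _ _; link 6%N
  | by [] ].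

Lemma exists_corner (a : pred corner) :
  [exists c, a c] = [|| a NW, a NE, a SW | a SE].
Proof.
apply/existsP/idP => [[[[] []]]|/or4P[] h]; rewrite /NW /NE /SW /SE.
all: by [move=> -> ; rewrite ?orbT | exists NW | exists NE | exists SW | exists SE].
Qed.

(** Each smoothing of a crossing below the tangle contracts this closure to one of
    the two closures of the tangle. *)
Lemma bracket_denom_L S : tangle_ok S ->
  bracket (D (vsum S cross)) = A * bracket (numer_closure S) + A^-1 * bracket (D S).
Proof.
case: S => n js te [/= c j e].
rewrite /bracket /D /numer_closure /= /juxt_joins cats0 /shift_end /= addn0 addn1.
case: n c j e => // n _ j e.
have ne c : ((te c).1 == n.+1) = false by rewrite ltn_eqF.
rewrite bracket_last; congr (_ * _ + _ * _).
- contract e ne [:: (te NW, te NE); (te SW, te SE)]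
    (fun c : corner => te (~~ c.1, c.2)) (xpred0 : pred corner).
  by rewrite exists_corner mul1r.
- contract e ne [:: (te NW, te SW); (te NE, te SE)]
    (fun c : corner => te (~~ c.1, c.2)) (xpred0 : pred corner).
  by rewrite exists_corner mul1r.
Qed.

(** The closing arc turns the crossing into a kink, one smoothing of which splits
    off a circle. *)
Lemma bracket_numer_L S : tangle_ok S ->
  bracket (numer_closure (vsum S cross)) =
  A * (delta * bracket (numer_closure S)) + A^-1 * bracket (numer_closure S).
Proof.
case: S => n js te [/= c j e].
rewrite /bracket /D /numer_closure /= /juxt_joins cats0 /shift_end /= addn0 addn1.
case: n c j e => // n _ j e.
have ne c : ((te c).1 == n.+1) = false by rewrite ltn_eqF.
rewrite bracket_last; congr (_ * _ + _ * _).
- contract e ne [:: (te NW, te NE); (te SW, te SE)]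
    (fun c : corner => te (true, c.2)) ((fun c => c.1) : pred corner).
  by rewrite exists_corner.
- contract e ne [:: (te NW, te NE); (te SW, te SE)]
    (fun c : corner => te (true, c.2)) (xpred0 : pred corner).
  by rewrite exists_corner mul1r.
Qed.

(** Again a kink, the closing arc being on the right. *)
Lemma bracket_denom_R S : tangle_ok S ->
  bracket (D (hsum S cross)) = A * bracket (D S) + A^-1 * (delta * bracket (D S)).
Proof.
case: S => n js te [/= c j e].
rewrite /bracket /D /numer_closure /= /juxt_joins cats0 /shift_end /= addn0 addn1.
case: n c j e => // n _ j e.
have ne c : ((te c).1 == n.+1) = false by rewrite ltn_eqF.
rewrite bracket_last; congr (_ * _ + _ * _).
- contract e ne [:: (te NW, te SW); (te NE, te SE)]
    (fun c : corner => te (c.1, true)) (xpred0 : pred corner).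
  by rewrite exists_corner mul1r.
- contract e ne [:: (te NW, te SW); (te NE, te SE)]
    (fun c : corner => te (c.1, true)) ((fun c => c.2) : pred corner).
  by rewrite exists_corner.
Qed.

Lemma bracket_numer_R S : tangle_ok S ->
  bracket (numer_closure (hsum S cross)) =
  A * bracket (numer_closure S) + A^-1 * bracket (D S).
Proof.
case: S => n js te [/= c j e].
rewrite /bracket /D /numer_closure /= /juxt_joins cats0 /shift_end /= addn0 addn1.
case: n c j e => // n _ j e.
have ne c : ((te c).1 == n.+1) = false by rewrite ltn_eqF.
rewrite bracket_last; congr (_ * _ + _ * _).
- contract e ne [:: (te NW, te NE); (te SW, te SE)]
    (fun c : corner => te (c.1, ~~ c.2)) (xpred0 : pred corner).
  by rewrite exists_corner mul1r.
- contract e ne [:: (te NW, te SW); (te NE, te SE)]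
    (fun c : corner => te (c.1, ~~ c.2)) (xpred0 : pred corner).
  by rewrite exists_corner mul1r.
Qed.

(** With a single crossing the circles are the fibres of a retraction of its four
    corners. *)
Lemma circles1 (T : finType) (h : T -> corner) (rho : corner -> T) arcs :
  cancel h rho -> arcs_below 1 arcs ->
  (forall c, linked arcs (0%N, c) (0%N, h (rho c))) ->
  (forall e, e \in arcs -> rho e.1.2 = rho e.2.2) ->
  circles 1 arcs = #|T|.
Proof.
move=> hK below hrho E; rewrite circlesE -n_comp_pred0.
apply: (n_comp_retract (h := fun t => (ord0, h t)) (rho := fun x => rho x.2)) => //.
- exact: arc_rel_sym.
- by apply: sym_connect_sym.
- by move=> x _; apply: linked_connect => //; case: x => i c; rewrite (ord1 i); apply: hrho.
- by move=> x y _ /orP[] /E /= ->; apply: connect0.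
Qed.

Lemma bracket_cross : (bracket (numer_closure cross) = A * delta + A^-1 * 1) *
                      (bracket (D cross) = A * 1 + A^-1 * delta).
Proof.
rewrite /bracket /= /smoothA /smoothB.
have one arcs := @circles1 unit (fun=> NW) (fun=> tt) arcs.
have two_v arcs := @circles1 bool (fun b => (false, b)) (fun c => c.2) arcs.
have two_h arcs := @circles1 bool (fun b => (b, false)) (fun c => c.1) arcs.
split; congr (_ * _ + _ * _).
- rewrite two_h ?card_bool //; corners.
  + by move=> [[] []]; link 6%N.
  + by move=> e; rewrite !inE; do ?[case/orP]; move/eqP->.
- by rewrite one ?card_unit //; corners; [case | move=> [[] []]; link 6%N].
- by rewrite one ?card_unit //; corners; [case | move=> [[] []]; link 6%N].
- rewrite two_v ?card_bool //; corners.
  + by move=> [[] []]; link 6%N.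
  + by move=> e; rewrite !inE; do ?[case/orP]; move/eqP->.
Qed.

(** * The bracket of a word and its symmetries *)

Section Kauffman.
Variables (Rg : comNzRingType) (a b d : Rg).

(** The bracket of both closures, numerator first, after one more crossing.  Here
    a and b stand for A and its inverse and d for delta; the symmetries below hold
    without any relation between them. *)
Definition bracket_step (v : Rg * Rg) (l : letter) : Rg * Rg :=
  if l is L then (a * (d * v.1) + b * v.1, a * v.1 + b * v.2)
  else (a * v.1 + b * v.2, a * v.2 + b * (d * v.2)).

Definition closures (w : seq letter) : Rg * Rg :=
  foldl bracket_step (a * d + b * 1, a * 1 + b * d) w.

Definition kauffman (w : seq letter) : Rg := a * (closures w).1 + b * (closures w).2.

(** The transposes of the matrices of [bracket_step]. *)
Definition bracket_stepT (l : letter) (u : Rg * Rg) : Rg * Rg :=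
  if l is L then ((a * d + b) * u.1 + a * u.2, b * u.2)
  else (a * u.1, b * u.1 + (a + b * d) * u.2).

(** The matrix of the brackets of both closures of both tangles without
    crossings; it relates the coordinates of a tangle in this basis to its closures. *)
Definition gram (u : Rg * Rg) : Rg * Rg := (d * u.1 + u.2, u.1 + d * u.2).

Lemma bracket_step_gram u l : bracket_step (gram u) l = gram (bracket_stepT l u).
Proof. by case: l; congr pair; rewrite /=; ring. Qed.

Lemma dot_bracket_step u v l :
  u.1 * (bracket_step v l).1 + u.2 * (bracket_step v l).2 =
  (bracket_stepT l u).1 * v.1 + (bracket_stepT l u).2 * v.2.
Proof. by case: l => /=; ring. Qed.

(** Transposing the product of the matrices reverses the word; the initial vector
    is the image under [gram] of the final row (a, b). *)
Lemma kauffman_rev w : kauffman (rev w) = kauffman w.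
Proof.
have v0 : (a * d + b * 1, a * 1 + b * d) = gram (a, b) by congr pair => /=; ring.
have fold_mx u w1 : foldl bracket_step (gram u) w1 =
    gram (foldl (fun v l => bracket_stepT l v) u w1).
  by elim: w1 u => //= l w1 IH u; rewrite bracket_step_gram IH.
have fold_dot u v w1 : u.1 * (foldl bracket_step v w1).1 + u.2 * (foldl bracket_step v w1).2 =
    (foldr bracket_stepT u w1).1 * v.1 + (foldr bracket_stepT u w1).2 * v.2.
  by elim: w1 v => //= l w1 IH v; rewrite IH dot_bracket_step.
rewrite /kauffman /closures v0 (fold_dot (a, b)) fold_mx -[foldr _ _ (rev w)]foldl_rev revK /=.
by set u := foldl _ _ _; ring.
Qed.

End Kauffman.

Lemma kauffman_flip (Rg : comNzRingType) (a b d : Rg) w :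
  kauffman b a d (map flip w) = kauffman a b d w.
Proof.
suff E : closures b a d (map flip w) = ((closures a b d w).2, (closures a b d w).1).
  by rewrite /kauffman E /= addrC.
have gen u : foldl (bracket_step b a d) (u.2, u.1) (map flip w) =
    ((foldl (bracket_step a b d) u w).2, (foldl (bracket_step a b d) u w).1).
  elim: w u => //= l w IH u; rewrite -IH; congr foldl.
  by case: l; congr pair; rewrite addrC.
by rewrite /closures -gen /=; congr foldl; congr pair; rewrite addrC.
Qed.

Lemma kauffman_morph (Rg Sg : comNzRingType) (f : {rmorphism Rg -> Sg}) a b d w :
  f (kauffman a b d w) = kauffman (f a) (f b) (f d) w.
Proof.
suff [E1 E2] : (f (closures a b d w).1 = (closures (f a) (f b) (f d) w).1) /\
    (f (closures a b d w).2 = (closures (f a) (f b) (f d) w).2).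
  by rewrite /kauffman rmorphD !rmorphM E1 E2.
have gen v u : f v.1 = u.1 /\ f v.2 = u.2 ->
    f (foldl (bracket_step a b d) v w).1 = (foldl (bracket_step (f a) (f b) (f d)) u w).1 /\
    f (foldl (bracket_step a b d) v w).2 = (foldl (bracket_step (f a) (f b) (f d)) u w).2.
  elim: w v u => //= l w IH v u [E1 E2]; apply: IH.
  by case: l; rewrite /= !rmorphD !rmorphM E1 E2.
by apply: gen; rewrite /= !rmorphD !rmorphM !rmorph1.
Qed.

Lemma bracket_word_tangle w :
  (bracket (numer_closure (word_tangle w)), bracket (D (word_tangle w))) =
  closures A A^-1 delta w.
Proof.
elim/last_ind: w => [|w l IH].
  by rewrite /word_tangle /= !bracket_cross.
rewrite /word_tangle /closures -cats1 !foldl_cat /= -/(word_tangle w) -/(closures _ _ _ w) -IH.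
have ok := word_tangle_ok w.
by case: l; rewrite /= ?bracket_denom_L ?bracket_numer_L ?bracket_denom_R ?bracket_numer_R.
Qed.

Lemma bracket_T w : bracket (D (T (rat_of_word w))) = kauffman A A^-1 delta w.
Proof.
have -> : bracket (D (T (rat_of_word w))) = bracket (D (word_tangle (rcons w L))).
  case: (T_rat_of_word w) => c j e; rewrite /bracket /= c; apply: eq_bracket => x.
  by rewrite !inE j !e.
rewrite /word_tangle -cats1 foldl_cat /= -/(word_tangle w) (bracket_denom_L (word_tangle_ok w)).
by rewrite /kauffman -bracket_word_tangle.
Qed.

Lemma evD (p q : {poly int}) (x : K) : ev (p + q) x = ev p x + ev q x.
Proof. by rewrite /ev [map_poly _ _]rmorphD /= hornerD. Qed.

Lemma ev1 (x : K) : ev 1 x = 1.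
Proof. by rewrite /ev [map_poly _ _]rmorph1 hornerC. Qed.

Lemma frac_repr (f : K) : exists n d : {poly int},
  d != 0 /\ f = FracField.tofrac n / FracField.tofrac d.
Proof.
exists (\n_(repr f))%R, (\d_(repr f))%R; split; first exact: denom_ratioP.
by rewrite -fracE mulfK // tofrac_eq0 denom_ratioP.
Qed.

Lemma bar_add f g : bar (f + g) = bar f + bar g.
Proof.
have [n [d [d0 ->]]] := frac_repr f; have [m [e [e0 ->]]] := frac_repr g.
rewrite addf_div ?tofrac_eq0 // -!tofracM -tofracD !bar_frac ?mulf_neq0 //.
by rewrite addf_div ?ev_neq0 // evD !evM.
Qed.

Lemma bar_mul f g : bar (f * g) = bar f * bar g.
Proof.
have [n [d [d0 ->]]] := frac_repr f; have [m [e [e0 ->]]] := frac_repr g.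
by rewrite mulf_div -!tofracM !bar_frac ?mulf_neq0 // mulf_div !evM.
Qed.

Lemma bar1 : bar 1 = 1.
Proof.
have -> : 1 = FracField.tofrac 1 / FracField.tofrac 1 :> K by rewrite tofrac1 divr1.
by rewrite bar_frac ?oner_neq0 // ev1 divr1.
Qed.

Lemma bar_is_zmod_morphism : zmod_morphism bar.
Proof.
have bar0 : bar 0 = 0 by apply: (@addrI _ (bar 0)); rewrite -bar_add !addr0.
move=> f g; rewrite bar_add; congr (_ + _).
by apply: (@addrI _ (bar g)); rewrite -bar_add !subrr.
Qed.

(** Together with additivity, this makes bar the automorphism of the field that
    inverts A. *)
Lemma bar_is_monoid_morphism : monoid_morphism bar.
Proof. by split; [apply: bar1 | apply: bar_mul]. Qed.

HB.instance Definition _ := GRing.isZmodMorphism.Build K K bar bar_is_zmod_morphism.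
HB.instance Definition _ := GRing.isMonoidMorphism.Build K K bar bar_is_monoid_morphism.

Lemma bar_A : bar A = A^-1.
Proof.
have -> : A = FracField.tofrac 'X / FracField.tofrac 1 by rewrite tofrac1 divr1.
rewrite bar_frac ?oner_neq0 // ev1 divr1 /ev map_polyX hornerX.
by rewrite tofrac1 divr1.
Qed.

Lemma bar_AV : bar A^-1 = A.
Proof. by rewrite fmorphV /= bar_A invrK. Qed.

Lemma bar_kauffman w : bar (kauffman A A^-1 delta w) = kauffman A A^-1 delta (map flip w).
Proof.
rewrite kauffman_flip kauffman_morph /= bar_A bar_AV; congr (kauffman _ _ _ _).
by rewrite rmorphB rmorphN fmorphV rmorphXn /= bar_A exprVn invrK addrC.
Qed.

(** * Orientations of the tangle of a word *)

(** The states of the ends of an oriented tangle, two of which are directed inward: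
    up to reversal, what matters is which end agrees with NW, namely SE, NE or SW. *)
Inductive flow := Diag | Horiz | Vert.

Definition mate (t : flow) : corner :=
  match t with Diag => SE | Horiz => NE | Vert => SW end.

Definition fstep (l : letter) (t : flow) : flow :=
  match l, t with
  | L, Diag => Vert | L, Vert => Diag | L, Horiz => Horiz
  | R, Diag => Horiz | R, Horiz => Diag | R, Vert => Vert
  end.

(** The sign of the crossing that the letter adds: below, it is negative when the
    ends SW and SE agree; on the right, when NE and SE differ. *)
Definition fsign (l : letter) (t : flow) : int :=
  match l, t with L, Horiz => -1 | L, _ => 1 | R, Vert => 1 | R, _ => -1 end.

Fixpoint fwalk (w : seq letter) (t : flow) : flow :=
  if w is l :: w' then fwalk w' (fstep l t) else t.

Fixpoint flow_signs (w : seq letter) (t : flow) : int :=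
  if w is l :: w' then fsign l t + flow_signs w' (fstep l t) else 0.

Lemma fwalk_rcons w l t : fwalk (rcons w l) t = fstep l (fwalk w t).
Proof. by elim: w t => //= m w IH t; rewrite IH. Qed.

Lemma flow_signs_rcons w l t : flow_signs (rcons w l) t = flow_signs w t + fsign l (fwalk w t).
Proof. by elim: w t => [|m w IH] t /=; rewrite ?IH ?addrA // addrC. Qed.

(** The sign of the first crossing, and also that of the last one, which the final
    letter L adds; see [flow_writhe]. *)
Definition cross_sign (t : flow) : int := if t is Horiz then -1 else 1.

Record oriented (n : nat) (joins : seq (endpoint * endpoint)) (o : endpoint -> bool) :
    Prop := Oriented {
  oriented_cross : forall i, (i < n)%N -> o (i, NW) != o (i, SE) /\ o (i, NE) != o (i, SW);
  oriented_joins : forall x y, (x, y) \in joins -> o x != o y }.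

Definition has_flow (S : tangle) (o : endpoint -> bool) (t : flow) : Prop :=
  forall c, o (tend S c) = o (tend S NW) (+) ((c != NW) && (c != mate t)).

Definition sign_sum (n : nat) (o : endpoint -> bool) : int :=
  \sum_(i < n) (if o (i : nat, NW) == o (i : nat, NE) then -1 else 1).

Lemma oriented_add_cross S l o :
  oriented (tcross (add_cross S l)) (tjoins (add_cross S l)) o <->
  oriented (tcross S) (tjoins S) o /\
  [/\ o (tcross S, NW) != o (tcross S, SE), o (tcross S, NE) != o (tcross S, SW) &
    if l is L then o (tend S SW) != o (tcross S, NW) /\ o (tend S SE) != o (tcross S, NE)
    else o (tend S NE) != o (tcross S, NW) /\ o (tend S SE) != o (tcross S, SW)].
Proof.
have E : tcross (add_cross S l) = (tcross S).+1 by case: l; rewrite /= addn1.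
rewrite E; split.
- case=> oc oj; split.
    split=> [i lt|x y xy]; first exact/oc/ltnW.
    by apply: oj; case: l {E}; rewrite /= /juxt_joins cats0 !inE xy !orbT.
  have [h1 h2] := oc _ (ltnSn _).
  case: l E oj => _ /= oj; split => //; split; apply: oj; rewrite /shift_end /= addn0;
    by rewrite !inE eqxx ?orbT.
- case=> [[oc oj] [h1 h2 h3]]; split=> [i|x y].
    by rewrite ltnS leq_eqVlt => /orP[/eqP -> //|]; apply: oc.
  case: l h3 {E} => -[h3 h4] /=; rewrite /juxt_joins cats0 /shift_end /= addn0 !inE.
  all: by case/or3P => [/eqP[-> ->]|/eqP[-> ->]|/oj].
Qed.

(** The strands run straight through the new crossing, so the two ends it is glued
    to exchange their directions. *)
Lemma has_flow_add_cross S l o t :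
  oriented (tcross (add_cross S l)) (tjoins (add_cross S l)) o ->
  has_flow S o t ->
  has_flow (add_cross S l) o (fstep l t) /\
  sign_sum (tcross S + 1) o = sign_sum (tcross S) o + fsign l t.
Proof.
move=> /oriented_add_cross[_ [h1 h2 h3]] ht.
have := ht SE; have := ht SW; have := ht NE.
rewrite addn1 /sign_sum big_ord_recr /=.
have bits (a1 a2 a3 a4 b1 b2 b3 b4 : bool) : a1 != a4 -> a2 != a3 ->
    (if l is L then b3 != a1 /\ b4 != a2 else b2 != a1 /\ b4 != a3) ->
    b2 = b1 (+) ((NE != NW) && (NE != mate t)) ->
    b3 = b1 (+) ((SW != NW) && (SW != mate t)) ->
    b4 = b1 (+) ((SE != NW) && (SE != mate t)) ->
  [/\ (if a1 == a2 then -1 else 1) = fsign l t,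
      (if l is L then b2 else a2) = b1 (+) ((NE != NW) && (NE != mate (fstep l t))),
      (if l is L then a3 else b3) = b1 (+) ((SW != NW) && (SW != mate (fstep l t))) &
      a4 = b1 (+) ((SE != NW) && (SE != mate (fstep l t)))].
  move=> + + + E2 E3 E4; subst b2 b3 b4; case: l {h3}; case: t {ht} => /=;
  by case: a1; case: a2; case: a3; case: a4; case: b1 => //= _ _ [].
move=> e1 e2 e3; have [s1 f2 f3 f4] := bits _ _ _ _ _ _ _ _ h1 h2 h3 e1 e2 e3.
split; last by congr (_ + _).
move=> [[] []]; move: f2 f3 f4.
all: case: (l) => /=; rewrite /shift_end /= ?addn0 //.
all: by rewrite addbF.
Qed.

Lemma word_tangle_rcons w l : word_tangle (rcons w l) = add_cross (word_tangle w) l.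
Proof. by rewrite /word_tangle -cats1 foldl_cat. Qed.

Lemma tcross_add_cross S l : tcross (add_cross S l) = (tcross S + 1)%N.
Proof. by case: l. Qed.

Lemma oriented_word_tangle w o :
  oriented (tcross (word_tangle w)) (tjoins (word_tangle w)) o ->
  exists t, [/\ t <> Diag, has_flow (word_tangle w) o (fwalk w t) &
    sign_sum (tcross (word_tangle w)) o = cross_sign t + flow_signs w t].
Proof.
elim/last_ind: w => [|w l IH].
  case=> /(_ 0%N isT)[h1 h2] _; exists (if o (0%N, NW) == o (0%N, NE) then Horiz else Vert).
  split.
  - by case: ifP.
  - move=> [[] []] /=; move: h1 h2; rewrite -/NW -/NE -/SE -/SW;
    by case: (o (0%N, NW)); case: (o (0%N, NE)); case: (o (0%N, SW));
      case: (o (0%N, SE)).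
  - by rewrite /sign_sum big_ord_recr big_ord0 /= add0r addr0; case: ifP.
rewrite word_tangle_rcons => or; have /oriented_add_cross[/IH[t [tD ft st]] _] := or.
have [f s] := has_flow_add_cross or ft.
exists t; rewrite fwalk_rcons flow_signs_rcons; split=> //.
by rewrite tcross_add_cross s st addrA.
Qed.

Lemma has_flow_ext S o o' t :
  (forall c, o (tend S c) = o' (tend S c)) -> has_flow S o t -> has_flow S o' t.
Proof. by move=> E h c; rewrite -!E. Qed.

(** Gluing a crossing to two ends never obstructs an orientation: it extends in a
    unique way. *)
Lemma word_tangle_orientation w t : t <> Diag -> exists2 o,
  oriented (tcross (word_tangle w)) (tjoins (word_tangle w)) o &
  has_flow (word_tangle w) o (fwalk w t).
Proof.
move=> tD; elim/last_ind: w => [|w l [o oo fo]].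
  exists (fun e => (e.2 != NW) && (e.2 != mate t)).
    split=> // i; by case: t tD.
  by move=> c /=; case: c => [[] []].
rewrite word_tangle_rcons fwalk_rcons; set S := word_tangle w in oo fo *.
have ok : tangle_ok S := word_tangle_ok w.
pose bits (c : corner) := if l is L then
    if (c == NW) || (c == SE) then (c == SE) (+) ~~ o (tend S SW)
    else (c == SW) (+) ~~ o (tend S SE)
  else if (c == NW) || (c == SE) then (c == SE) (+) ~~ o (tend S NE)
    else (c == NE) (+) ~~ o (tend S SE).
pose o' (e : endpoint) := if e.1 == tcross S then bits e.2 else o e.
have oldE x : (x.1 < tcross S)%N -> o' x = o x by move=> lt; rewrite /o' ltn_eqF.
have newE c : o' (tcross S, c) = bits c by rewrite /o' eqxx.
have endE c : o' (tend S c) = o (tend S c) by apply/oldE/tangle_ok_end.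
have oo' : oriented (tcross (add_cross S l)) (tjoins (add_cross S l)) o'.
  apply/oriented_add_cross; split.
    split=> [i lt|x y xy]; first by rewrite !oldE //; case: oo => + _; apply.
    have /allP/(_ _ xy)/andP[h1 h2] := tangle_ok_joins ok.
    by rewrite !oldE //; case: oo => _; apply.
  by rewrite !newE !endE /bits; split; case: (l) => /=; try split;
    case: (o (tend S SW)); case: (o (tend S NE)); case: (o (tend S SE)).
exists o' => //.
by have [] := has_flow_add_cross oo' (has_flow_ext (fun c => esym (endE c)) fo).
Qed.

(** Orientations as functions on all endpoints, so that the number of crossings can
    be rewritten. *)
Definition extend (n : nat) (o : {ffun 'I_n * corner -> bool}) (e : endpoint) : bool :=
  if insub e.1 is Some i then o (i, e.2) else false.

Lemma extend_pt n (o : {ffun 'I_n * corner -> bool}) x : extend o (pt x) = o x.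
Proof. by case: x => i c; rewrite /extend /= valK. Qed.

Lemma is_orientationP (E : diagram) (o : {ffun 'I_(dcross E) * corner -> bool}) :
  arcs_below (dcross E) (djoins E) ->
  reflect (oriented (dcross E) (djoins E) (extend o)) (is_orientation o).
Proof.
move=> below; have lift (a : endpoint) : (a.1 < dcross E)%N ->
    {x : 'I_(dcross E) * corner | pt x = a}.
  by case: a => i c /= lt; exists (Ordinal lt, c).
apply: (iffP andP) => [[/forallP h /forallP j]|[h j]].
  split=> [i lt|x y xy].
    by have /andP := h (Ordinal lt); rewrite -!(extend_pt o).
  have /andP[/lift[x' Ex] /lift[y' Ey]] := allP below _ xy.
  move/forallP: (j x') => /(_ y'); rewrite -!(extend_pt o) Ex Ey.
  by move/implyP; apply.
split; apply/forallP=> x.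
  by have [h1 h2] := h _ (ltn_ord x); rewrite -!(extend_pt o) h1.
by apply/forallP => y; apply/implyP; rewrite -!(extend_pt o); apply: j.
Qed.

Lemma writheE (E : diagram) (o : {ffun 'I_(dcross E) * corner -> bool}) :
  writhe o = sign_sum (dcross E) (extend o).
Proof. by apply: eq_bigr => i _; rewrite -!(extend_pt o). Qed.

Lemma eq_oriented n joins o o' :
  arcs_below n joins -> (forall e, (e.1 < n)%N -> o e = o' e) ->
  oriented n joins o -> oriented n joins o'.
Proof.
move=> below E [h j]; split=> [i lt|x y xy].
  by rewrite -!E //; apply: h.
by have /andP[h1 h2] := allP below _ xy; rewrite -!E //; apply: j.
Qed.

(** The flows at the first crossing that survive the closing of the tangle.  The
    final letter L turns Diag into Vert, for which the closing arcs do not match, and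
    Vert into Diag, for which they run in opposite directions; the last condition
    is for links with two components. *)
Definition admissible (w : seq letter) (t : flow) : Prop :=
  [/\ t <> Diag, fwalk w t <> Diag & fwalk w Diag = Diag -> fwalk w t = Vert].

Lemma fstepK l : involutive (fstep l). Proof. by case: l => -[]. Qed.

Lemma fwalk_inj w : injective (fwalk w).
Proof.
by elim: w => //= l w IH t u /IH/(congr1 (fstep l)); rewrite !fstepK.
Qed.

(** The flow Diag cannot start and must not arrive.  If it is fixed, the walk has to
    arrive at Vert; otherwise exactly one of the other two avoids arriving at Diag. *)
Definition start_flow (w : seq letter) : flow :=
  match fwalk w Diag, fwalk w Horiz with
  | Diag, Vert => Horiz
  | Diag, _ => Vert
  | _, Diag => Vert
  | _, _ => Horiz
  end.

Lemma admissible_start w : admissible w (start_flow w).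
Proof.
have [h1 h2 h3] : [/\ fwalk w Diag <> fwalk w Horiz, fwalk w Diag <> fwalk w Vert &
    fwalk w Horiz <> fwalk w Vert] by split=> /fwalk_inj.
rewrite /admissible /start_flow; move: h1 h2 h3.
case E1: (fwalk w Diag); case E2: (fwalk w Horiz); case E3: (fwalk w Vert) => //.
all: by split=> //; rewrite ?E1 ?E2 ?E3.
Qed.

Lemma admissible_unique w t : admissible w t -> t = start_flow w.
Proof.
have [h1 h2 h3] : [/\ fwalk w Diag <> fwalk w Horiz, fwalk w Diag <> fwalk w Vert &
    fwalk w Horiz <> fwalk w Vert] by split=> /fwalk_inj.
rewrite /admissible /start_flow; move: h1 h2 h3.
case E1: (fwalk w Diag); case E2: (fwalk w Horiz); case E3: (fwalk w Vert) => //.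
all: by case: t; rewrite ?E1 ?E2 ?E3 => // _ _ _ [] // _ _ /(_ erefl).
Qed.

Definition flow_writhe (w : seq letter) (t : flow) : int :=
  cross_sign t + flow_signs w t + cross_sign (fwalk w t).

Definition word_writhe (w : seq letter) : int := flow_writhe w (start_flow w).

(** * The writhe of a word and its symmetries *)

Definition evenz (n : int) : bool := (2 %| n)%Z.

Lemma evenzD m n : evenz (m + n) = (evenz m == evenz n).
Proof. by rewrite /evenz; apply/idP/eqP; lia. Qed.

Lemma evenzN n : evenz (- n) = evenz n.
Proof. by rewrite /evenz; apply/idP/idP; lia. Qed.

Lemma evenzM m n : evenz (m * n) = evenz m || evenz n.
Proof. by rewrite /evenz dvdzE abszM Euclid_dvdM. Qed.

(** The three points of the projective line over the field with two elements, in
    terms of the evenness of the coordinates. *)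
Definition parity_flow (m n : bool) : flow :=
  if m then Horiz else if n then Diag else Vert.

(** Modulo 2, the letters permute the fraction and its two parents, in the same way
    as they permute the flows. *)
Lemma fwalk_farey w : let: (x, s, y, r) := farey w in
  [/\ fwalk w Diag = parity_flow (evenz (x + y)) (evenz (s + r)),
      fwalk w Horiz = parity_flow (evenz x) (evenz s) &
      fwalk w Vert = parity_flow (evenz y) (evenz r)].
Proof.
elim: w => [|l w] //=; have := fareyP w.
case: (farey w) => [[[x s] y] r] [_ det] [h1 h2 h3].
have : ~~ evenz (s * y - x * r) by rewrite det.
rewrite [evenz (_ - _)]evenzD evenzN !evenzM => detP.
move: h1 h2 h3 detP; rewrite !evenzD.
by case: l => /= -> -> ->; rewrite !evenzD; case: (evenz x); case: (evenz y); case: (evenz s);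
  case: (evenz r).
Qed.

Lemma evenz_denq w : evenz (denq (rat_of_word w)) <-> fwalk w Diag = Diag.
Proof.
have := fwalk_farey w; have := fareyP w; rewrite denq_rat_of_word.
case: (farey w) => [[[x s] y] r] [_ det] [-> _ _].
have : ~~ evenz (s * y - x * r) by rewrite det.
rewrite [evenz (_ - _)]evenzD evenzN !evenzM !evenzD.
by case: (evenz x); case: (evenz y); case: (evenz s); case: (evenz r).
Qed.

(** Orientations of the diagram are orientations of the tangle of the word whose
    flow is admissible, and these have the same writhe. *)
Lemma wr_rat_of_word w : wr (rat_of_word w) = word_writhe w.
Proof.
have [cE jE eE] := T_rat_of_word w; set W := word_tangle _ in cE jE eE.
have ok : tangle_ok W := word_tangle_ok _.
pose E := D (T (rat_of_word w)).
have below : arcs_below (dcross E) (djoins E).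
  rewrite /arcs_below /= (eq_all_r jE) cE !eE !tangle_ok_end //=.
  exact: tangle_ok_joins ok.
(* An orientation of the closure is one of the tangle that fits both arcs. *)
have oE o : oriented (dcross E) (djoins E) o <->
    [/\ oriented (tcross W) (tjoins W) o, o (tend W NW) != o (tend W SW) &
        o (tend W NE) != o (tend W SE)].
  split=> [[h j]|[[h j] h1 h2]].
    split; first split.
    - by rewrite -cE.
    - by move=> x y xy; apply: j; rewrite !inE jE xy !orbT.
    - by rewrite -!eE; apply: j; rewrite !inE eqxx.
    - by rewrite -!eE; apply: j; rewrite !inE eqxx orbT.
  split; first by rewrite /= cE.
  move=> x y; rewrite !inE !eE jE.
  by case/or3P => [/eqP[-> ->]|/eqP[-> ->]|/j].
have lift (a : endpoint) : (a.1 < tcross W)%N ->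
    exists x : 'I_(dcross E) * corner, pt x = a.
  by case: a => i c; rewrite -cE => lt; exists (Ordinal (lt : i < dcross E)%N, c).
have oppE (o : {ffun 'I_(dcross E) * corner -> bool}) :
    opposite_closing_arcs (S := T (rat_of_word w)) o <->
    extend o (tend W NW) != extend o (tend W NE).
  split.
    have [x Ex] := lift _ (tangle_ok_end ok NW).
    have [y Ey] := lift _ (tangle_ok_end ok NE).
    move/forallP/(_ x)/forallP/(_ y); rewrite Ex Ey !eE !eqxx.
    by rewrite -Ex -Ey !extend_pt.
  move=> h; apply/forallP => x; apply/forallP => y; apply/implyP.
  by rewrite -!(extend_pt o) => /andP[/eqP-> /eqP->]; rewrite !eE.
have signE t : cross_sign t + flow_signs (rcons w L) t = flow_writhe w t.
  by rewrite flow_signs_rcons /flow_writhe addrA; case: (fwalk w t).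
have final t o : has_flow W o (fwalk (rcons w L) t) ->
    [/\ (o (tend W NW) != o (tend W SW)) && (o (tend W NE) != o (tend W SE)) <->
         fwalk w t <> Diag &
        o (tend W NW) != o (tend W NE) -> fwalk w t <> Horiz] /\
    (fwalk w t = Vert -> o (tend W NW) != o (tend W NE)).
  move=> h; have := h SE; have := h SW; have := h NE; rewrite fwalk_rcons.
  by case: (fwalk w t) => /= -> -> ->; case: (o _); split=> //; split.
have good (o : {ffun 'I_(dcross E) * corner -> bool}) :
    is_orientation (E := E) o &&
      ((2 %| denq (rat_of_word w))%Z ==> opposite_closing_arcs (S := T (rat_of_word w)) o) ->
    writhe o = word_writhe w.
  case/andP=> /(is_orientationP _ below)/oE[oW h1 h2] /implyP opp.
  have [t [tD ft st]] := oriented_word_tangle oW.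
  have [[f1 f2] f3] := final _ _ ft.
  have adm : admissible w t.
    split=> //; first by apply/f1; rewrite h1 h2.
    move/evenz_denq => /opp/oppE/f2.
    have : fwalk w t <> Diag by apply/f1; rewrite h1 h2.
    by case: (fwalk w t).
  have -> : writhe o = sign_sum (tcross W) (extend o) by rewrite writheE -cE.
  by rewrite st signE /word_writhe -(admissible_unique adm).
have [adm1 adm2 adm3] := admissible_start w.
have [o oW fo] := word_tangle_orientation (rcons w L) adm1.
pose oo : {ffun 'I_(dcross E) * corner -> bool} := [ffun x => o (pt x)].
have ooE e : (e.1 < dcross E)%N -> o e = extend oo e.
  case: e => i c lt; rewrite -[(i, c)]/(pt (Ordinal lt : 'I_(dcross E), c)).
  by rewrite extend_pt ffunE.
have [[f1 f2] f3] := final _ _ fo.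
have okoo : is_orientation (E := E) oo &&
      ((2 %| denq (rat_of_word w))%Z ==> opposite_closing_arcs (S := T (rat_of_word w)) oo).
  apply/andP; split.
    apply/(is_orientationP _ below)/(eq_oriented below ooE)/oE.
    by have /f1/andP[h1 h2] := adm2.
  have endW c : ((tend W c).1 < dcross E)%N by rewrite /= cE tangle_ok_end.
  apply/implyP => /evenz_denq/adm3/f3; rewrite !ooE //.
  by move/oppE.
rewrite /wr; case: (pickP (fun o : {ffun 'I_(dcross E) * corner -> bool} =>
  is_orientation (E := E) o && ((2 %| denq (rat_of_word w))%Z ==>
    opposite_closing_arcs (S := T (rat_of_word w)) o))) => [o1 /good //|none].
by have := none oo; rewrite okoo.
Qed.

(** Each letter acts by an involution. *)
Lemma fwalk_rev w t : fwalk (rev w) (fwalk w t) = t.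
Proof.
elim: w t => //= l w IH t; rewrite rev_cons fwalk_rcons IH; exact: fstepK.
Qed.

Lemma flow_signs_rev w t : flow_signs (rev w) (fwalk w t) = flow_signs w t.
Proof.
elim: w t => //= l w IH t; rewrite rev_cons flow_signs_rcons IH fwalk_rev addrC.
by case: l; case: t.
Qed.

Lemma flow_writhe_rev w t : flow_writhe (rev w) (fwalk w t) = flow_writhe w t.
Proof. by rewrite /flow_writhe flow_signs_rev fwalk_rev; ring. Qed.

Definition fmirror (t : flow) : flow :=
  match t with Diag => Diag | Horiz => Vert | Vert => Horiz end.

Lemma fwalk_flip w t : fwalk (map flip w) (fmirror t) = fmirror (fwalk w t).
Proof. by elim: w t => //= l w IH t; rewrite -IH; case: l; case: t. Qed.

Lemma flow_writhe_flip w t : t <> Diag -> fwalk w t <> Diag ->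
  flow_writhe (map flip w) (fmirror t) = - flow_writhe w t.
Proof.
have fs u : flow_signs (map flip w) (fmirror u) = - flow_signs w u.
  elim: (w) u => /= [|l v IH] u; first by rewrite oppr0.
  by rewrite opprD -IH; case: l; case: u.
move=> h1 h2; rewrite /flow_writhe fs fwalk_flip !opprD.
by case: t h1 h2 => //; case: (fwalk _ _).
Qed.

(** The reversed walk is admissible for the reversed word, except when the walk goes
    from Horiz to Vert while Diag is fixed. *)
Lemma word_writhe_rev w : fwalk w Diag <> Diag \/ fwalk w Horiz = Horiz ->
  word_writhe (rev w) = word_writhe w.
Proof.
have [h1 h2 h3] := admissible_start w => h.
rewrite /word_writhe -[in RHS]flow_writhe_rev; congr flow_writhe; apply/esym/admissible_unique.
have E : fwalk (rev w) Diag = Diag <-> fwalk w Diag = Diag.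
  split=> e; last by rewrite -{1}e fwalk_rev.
  by rewrite -{1}e -{1}(revK w) fwalk_rev.
split; rewrite ?fwalk_rev // => /E e.
case: h => [//|hh]; have := h3 e.
by case Es: (start_flow w) h1 => [||] // _; rewrite hh.
Qed.

Lemma word_writhe_flip w : fwalk w Diag <> Diag -> word_writhe (map flip w) = - word_writhe w.
Proof.
have [h1 h2 h3] := admissible_start w => h.
rewrite /word_writhe -flow_writhe_flip //; congr flow_writhe.
apply/esym/admissible_unique; split.
- by case: (start_flow w) h1.
- by rewrite fwalk_flip; case: (fwalk w _) h2.
- rewrite -[Diag in LHS]/(fmirror Diag) fwalk_flip.
  by case: (fwalk w Diag) h.
Qed.

(** The walk goes from Horiz to Vert; reversing and then reflecting it gives a walk
    from Horiz to Vert again. *)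
Lemma word_writhe_flip_rev w : fwalk w Diag = Diag -> fwalk w Horiz = Vert ->
  word_writhe (map flip (rev w)) = - word_writhe w.
Proof.
move=> e1 e2; have [h1 h2 h3] := admissible_start w.
have e3 : fwalk w Vert = Horiz.
  case E: (fwalk w Vert) => //.
    by have := @fwalk_inj w Vert Diag; rewrite E e1 => /(_ erefl).
  by have := @fwalk_inj w Vert Horiz; rewrite E e2 => /(_ erefl).
have st : start_flow w = Horiz by rewrite /start_flow e1 e2.
have e4 : fwalk (rev w) Vert = Horiz by rewrite -e2 fwalk_rev.
have e5 : fwalk (map flip (rev w)) Horiz = Vert.
  by rewrite -[Horiz]/(fmirror Vert) fwalk_flip e4.
rewrite /word_writhe st -[flow_writhe w Horiz]flow_writhe_rev e2 -flow_writhe_flip ?e4 //.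
by congr flow_writhe; apply/esym/admissible_unique; split; rewrite ?e5.
Qed.

(** * Jones polynomials of words *)

Definition jones (w : seq letter) : K :=
  (- A ^+ 3) ^ (- word_writhe w) * kauffman A A^-1 delta w.

Lemma V_rat_of_word w : V (rat_of_word w) = jones w.
Proof. by rewrite /V wr_rat_of_word bracket_T. Qed.

Lemma bar_pow (z : int) : bar ((- A ^+ 3) ^ z) = (- A ^+ 3) ^ (- z).
Proof.
rewrite fmorphXz rmorphN rmorphXn /= bar_A -exprz_inv; congr (_ ^ _).
by rewrite invrN exprVn.
Qed.

Lemma map_flipK : involutive (map flip).
Proof. exact: mapK flipK. Qed.

Lemma bar_jones_K w : bar (bar (jones w)) = jones w.
Proof.
have -> : bar (jones w) = (- A ^+ 3) ^ word_writhe w * kauffman A A^-1 delta (map flip w).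
  by rewrite /jones bar_mul bar_pow opprK bar_kauffman.
by rewrite bar_mul bar_pow bar_kauffman map_flipK.
Qed.

Lemma jones_rev w : fwalk w Diag <> Diag \/ fwalk w Horiz = Horiz ->
  jones (rev w) = jones w.
Proof. by move=> h; rewrite /jones word_writhe_rev // kauffman_rev. Qed.

Lemma jones_flip w : fwalk w Diag <> Diag -> jones (map flip w) = bar (jones w).
Proof.
by move=> h; rewrite /jones word_writhe_flip // bar_mul bar_pow bar_kauffman.
Qed.

Lemma jones_flip_rev w : fwalk w Diag = Diag -> fwalk w Horiz = Vert ->
  jones (map flip (rev w)) = bar (jones w).
Proof.
move=> h1 h2; rewrite /jones word_writhe_flip_rev // bar_mul bar_pow bar_kauffman.
by rewrite map_rev kauffman_rev.
Qed.

Section FlowClass.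
Variable T : eqType.

(** The class on the level of words: the flow u is the image of Diag, which tells the
    parity of q, and v is the image of Horiz, which tells that of x. *)
Definition flow_class (u v : flow) (j j' bj bj' : T) : seq T :=
  match u, v with
  | Diag, Horiz => [:: j; j']
  | Diag, _ => [:: j; j'; bj'; bj]
  | _, _ => [:: j; bj]
  end.

Lemma flow_class_swap v j j' bj bj' :
  flow_class Diag v j j' bj bj' =i flow_class Diag v j' j bj' bj.
Proof.
by move=> f; case: v; rewrite !inE;
  case: (f == j); case: (f == j'); case: (f == bj); case: (f == bj').
Qed.

Lemma flow_class_bar v j j' bj bj' : v <> Horiz ->
  flow_class Diag v bj' bj j' j =i flow_class Diag v j j' bj bj'.
Proof.
by move=> h f; case: v h => // _; rewrite !inE;
  case: (f == j); case: (f == j'); case: (f == bj); case: (f == bj').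
Qed.

Lemma flow_classE u v j j' bj bj' : u <> Diag ->
  flow_class u v j j' bj bj' = [:: j; bj].
Proof. by case: u. Qed.

End FlowClass.

Definition word_class (w : seq letter) : seq K :=
  flow_class (fwalk w Diag) (fwalk w Horiz) (jones w) (jones (map flip w))
    (bar (jones w)) (bar (jones (map flip w))).

Lemma Vclass_word w x s y r f : parents (rat_of_word w) x s y r ->
  Vclass (rat_of_word w) x y f <-> f \in word_class w.
Proof.
move=> /parents_unique E; have := fwalk_farey w; have := fareyP w.
have D := denq_rat_of_word w; rewrite /Vclass -![(2 %| _)%Z]/(evenz _).
move: D; rewrite E => -> [_ det] [h1 h2 _].
have : ~~ evenz (s * y - x * r) by rewrite det.
rewrite irat_rat_of_word !V_rat_of_word /word_class h1 h2.
rewrite [evenz (_ - _)]evenzD evenzN !evenzM !evenzD.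
move: (jones w) (jones (map flip w)) => j j'; move: (bar j) (bar j') => bj bj'.
case: (evenz x); case: (evenz y); case: (evenz s); case: (evenz r) => //= _.
all: by split=> [[[]|[]|[]]|h] //; first [by apply: Or31 | by apply: Or32 | by apply: Or33].
Qed.

Lemma fwalk_flip_diag w : fwalk (map flip w) Diag = fmirror (fwalk w Diag).
Proof. by rewrite -fwalk_flip. Qed.

Lemma fwalk_rev_diag w : fwalk (rev w) Diag = Diag <-> fwalk w Diag = Diag.
Proof.
split=> e; last by rewrite -{1}e fwalk_rev.
by rewrite -{1}e -{1}(revK w) fwalk_rev.
Qed.

Lemma flow_diagP (t : flow) : t = Diag \/ t <> Diag.
Proof. by case: t; [left | right | right]. Qed.

Lemma fwalk_diag w : fwalk w Diag = Diag ->
  fwalk w Horiz = Horiz /\ fwalk w Vert = Vert \/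
  fwalk w Horiz = Vert /\ fwalk w Vert = Horiz.
Proof.
have i1 := @fwalk_inj w Horiz Diag; have i2 := @fwalk_inj w Vert Diag.
have i3 := @fwalk_inj w Horiz Vert => e.
case h: (fwalk w Horiz) i1 i3 => i1 i3; first by have := i1 (esym e).
all: case v: (fwalk w Vert) i2 i3 => i2 i3; try by have := i2 (esym e).
all: try by have := i3 erefl.
all: by [left | right].
Qed.

Lemma word_class_flip w : word_class (map flip w) =i word_class w.
Proof.
rewrite /word_class map_flipK => f.
have [e|e] := flow_diagP (fwalk w Diag).
  rewrite fwalk_flip_diag e flow_class_swap.
  suff -> : fwalk (map flip w) Horiz = fwalk w Horiz by [].
  rewrite -[Horiz in LHS]/(fmirror Vert) fwalk_flip.
  by case: (fwalk_diag e) => -[-> ->].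
have e' : fwalk (map flip w) Diag <> Diag.
  by rewrite fwalk_flip_diag; case: (fwalk w Diag) e.
rewrite (flow_classE _ _ _ _ _ e) (flow_classE _ _ _ _ _ e').
rewrite (jones_flip e) bar_jones_K; move: (jones w) (bar _) => j bj.
by rewrite !inE orbC.
Qed.

Lemma jones_rev_bar w : fwalk w Diag = Diag -> fwalk w Horiz = Vert ->
  jones (rev w) = bar (jones (map flip w)).
Proof.
move=> e h; have e' : fwalk (map flip w) Diag = Diag by rewrite fwalk_flip_diag e.
have h' : fwalk (map flip w) Horiz = Vert.
  rewrite -[Horiz]/(fmirror Vert) fwalk_flip.
  by case: (fwalk_diag e) => -[h1 ->] //; move: h1; rewrite h.
by rewrite -(jones_flip_rev e' h') map_rev map_flipK.
Qed.

Lemma word_class_rev w : word_class (rev w) =i word_class w.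
Proof.
rewrite /word_class => f; have [e|e] := flow_diagP (fwalk w Diag); last first.
  have e' : fwalk (rev w) Diag <> Diag by move/fwalk_rev_diag.
  rewrite (flow_classE _ _ _ _ _ e) (flow_classE _ _ _ _ _ e').
  by rewrite (jones_rev (or_introl e)).
have e' := (fwalk_rev_diag w).2 e; rewrite e e'.
case: (fwalk_diag e) => -[h v].
  have h' : fwalk (rev w) Horiz = Horiz by rewrite -{1}h fwalk_rev.
  have h2 : fwalk (map flip w) Horiz = Horiz.
    by rewrite -[Horiz]/(fmirror Vert) fwalk_flip v.
  by rewrite h h' map_rev (jones_rev (or_intror h)) (jones_rev (or_intror h2)).
have h' : fwalk (rev w) Horiz = Vert by rewrite -{1}v fwalk_rev.
rewrite h h' (jones_rev_bar e h) (jones_flip_rev e h) !bar_jones_K.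
exact: flow_class_bar.
Qed.

Lemma word_class_jones w f : f \in word_class w -> exists v, f = jones v.
Proof.
have E : [\/ f = jones w, f = jones (map flip w), f = jones (rev w) |
    f = jones (map flip (rev w))] -> exists v, f = jones v.
  by case; [exists w | exists (map flip w) | exists (rev w) | exists (map flip (rev w))].
rewrite /word_class => fw; apply: E; move: fw.
have [e|e] := flow_diagP (fwalk w Diag); last first.
  rewrite (flow_classE _ _ _ _ _ e) -(jones_flip e).
  move: (jones w) (jones _) (jones _) (jones _) => j1 j2 j3 j4.
  by rewrite !inE => /orP[] /eqP; [apply: Or41 | apply: Or42].
rewrite e; case: (fwalk_diag e) => -[h v]; rewrite h.
  move: (jones w) (jones (map _ w)) (jones (rev _)) (jones (map _ (rev _))) (bar _) (bar _).
  move=> j1 j2 j3 j4 b1 b2.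
  by rewrite !inE => /orP[] /eqP; [apply: Or41 | apply: Or42].
rewrite -(jones_rev_bar e h) -(jones_flip_rev e h).
move: (jones w) (jones (map _ w)) (jones (rev _)) (jones (map _ (rev _))).
move=> j1 j2 j3 j4; rewrite !inE.
by case/or4P=> /eqP; [apply: Or41 | apply: Or42 | apply: Or43 | apply: Or44].
Qed.

(** * Laurent polynomials in the square root of t *)

Local Notation sqrt_t := (A ^- 2).

Lemma sqrt_t_neq0 : sqrt_t != 0 :> K.
Proof. by rewrite invr_eq0 expf_neq0 // A_neq0. Qed.

Lemma evX (x : K) : ev 'X x = x.
Proof. by rewrite /ev map_polyX hornerX. Qed.

Lemma evXn n (x : K) : ev 'X^n x = x ^+ n.
Proof. by elim: n => [|n IH]; rewrite ?expr0 ?ev1 // !exprS evM evX IH. Qed.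

Lemma evN p (x : K) : ev (- p) x = - ev p x.
Proof. by rewrite /ev [map_poly _ _]rmorphN /= hornerN. Qed.

Lemma laurentM f g : laurent_sqrt_t f -> laurent_sqrt_t g -> laurent_sqrt_t (f * g).
Proof.
case=> [p [m ->]] [q [n ->]]; exists (p * q), (m + n)%N.
by rewrite evM exprD mulf_div.
Qed.

Lemma laurentD f g : laurent_sqrt_t f -> laurent_sqrt_t g -> laurent_sqrt_t (f + g).
Proof.
case=> [p [m ->]] [q [n ->]]; exists (p * 'X^n + q * 'X^m), (m + n)%N.
by rewrite addf_div ?expf_neq0 ?sqrt_t_neq0 // evD !evM !evXn exprD.
Qed.

Lemma laurentN f : laurent_sqrt_t f -> laurent_sqrt_t (- f).
Proof. by case=> [p [m ->]]; exists (- p), m; rewrite evN mulNr. Qed.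

Lemma laurent1 : laurent_sqrt_t 1.
Proof. by exists 1, 0%N; rewrite ev1 expr0 divr1. Qed.

Lemma laurent_u : laurent_sqrt_t sqrt_t.
Proof. by exists 'X, 0%N; rewrite evX expr0 divr1. Qed.

Lemma laurent_A2 : laurent_sqrt_t (A ^+ 2).
Proof. by exists 1, 1%N; rewrite ev1 expr1 invrK mul1r. Qed.

Lemma laurentX f n : laurent_sqrt_t f -> laurent_sqrt_t (f ^+ n).
Proof.
move=> h; elim: n => [|n IH]; first by rewrite expr0; apply: laurent1.
by rewrite exprS; apply: laurentM.
Qed.

Lemma laurent_delta : laurent_sqrt_t delta.
Proof.
by apply: laurentD; apply: laurentN; [apply: laurent_A2 | apply: laurent_u].
Qed.

(** Multiplication by A makes the exponents of both terms even again. *)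
Lemma step_exprE (F : fieldType) (a c v v' : F) : a != 0 ->
  (c * a) * (a * v + a^-1 * v') = a ^+ 2 * (c * v) + c * v'.
Proof. by move=> a0; field. Qed.

Lemma laurent_step (c v v' : K) : laurent_sqrt_t (c * v) -> laurent_sqrt_t (c * v') ->
  laurent_sqrt_t ((c * A) * (A * v + A^-1 * v')).
Proof.
move=> h h'; rewrite step_exprE ?A_neq0 //.
by apply: laurentD => //; apply: laurentM => //; apply: laurent_A2.
Qed.

Lemma laurent_closures w :
  laurent_sqrt_t (A ^+ (size w).+1 * (closures A A^-1 delta w).1) /\
  laurent_sqrt_t (A ^+ (size w).+1 * (closures A A^-1 delta w).2).
Proof.
elim/last_ind: w => [|w l [IH1 IH2]].
  have d1 : laurent_sqrt_t (1 * delta) by rewrite mul1r; apply: laurent_delta.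
  have d2 : laurent_sqrt_t (1 * 1) by rewrite mul1r; apply: laurent1.
  by rewrite expr1 -[A in A * _.1]mul1r -[A in A * _.2]mul1r; split; apply: laurent_step.
have dl v : laurent_sqrt_t (A ^+ (size w).+1 * v) ->
    laurent_sqrt_t (A ^+ (size w).+1 * (delta * v)).
  by move=> h; rewrite mulrCA; apply: laurentM => //; apply: laurent_delta.
rewrite size_rcons /closures -cats1 foldl_cat -/(closures _ _ _ w) exprSr.
by case: l; split; apply: laurent_step => //; apply: dl.
Qed.

Lemma flow_signs_parity w t : exists k, flow_signs w t = (size w)%:Z + 2 * k.
Proof.
elim: w t => [|l w IH] t /=; first by exists 0.
have [k ->] := IH (fstep l t).
by case: l; case: t => /=; (exists k; lia) || (exists (k - 1); lia).
Qed.

Lemma laurent_exprz f (z : int) : f != 0 -> laurent_sqrt_t f -> laurent_sqrt_t f^-1 ->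
  laurent_sqrt_t (f ^ z).
Proof.
move=> f0 h h'; case: z => n; first exact: laurentX.
by rewrite NegzE -exprnN -exprVn; apply: laurentX.
Qed.

(** The bracket has exponents of the parity of the number of crossings, and so has
    the correction by the writhe, which is a sum of as many signs. *)
Lemma laurent_jones w : laurent_sqrt_t (jones w).
Proof.
have [h1 h2] := laurent_closures w.
have hk : laurent_sqrt_t (A ^+ (size w) * kauffman A A^-1 delta w).
  have := laurent_step h1 h2; rewrite -exprSr -/(kauffman _ _ _ w).
  move/(laurentM laurent_u); rewrite mulrA; congr (laurent_sqrt_t (_ * _)).
  by rewrite -[(size w).+2]addn2 exprD mulrCA mulVf ?mulr1 // expf_neq0 // A_neq0.
have [k Ek] : exists k : int, - word_writhe w = 2 * k + (size w)%:Z.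
  have [k E] := flow_signs_parity w (start_flow w); rewrite /word_writhe /flow_writhe E.
  case: (start_flow w); case: (fwalk _ _) => /=;
  first [by exists (-1 - k - (size w)%:Z); lia | by exists (- k - (size w)%:Z); lia
        |by exists (1 - k - (size w)%:Z); lia].
have a3 : - A ^+ 3 != 0 :> K by rewrite oppr_eq0 expf_neq0 // A_neq0.
have sq : (- A ^+ 3) ^ 2 = (A ^+ 2) ^+ 3 :> K.
  by rewrite -[(_ ^ 2)]/(_ ^+ 2) sqrrN -!exprM.
rewrite /jones Ek expfzDr // -exprz_exp sq.
rewrite -mulrA; apply: laurentM.
  apply: laurent_exprz; rewrite ?expf_neq0 ?A_neq0 //.
    exact/laurentX/laurent_A2.
  by rewrite -exprVn; apply/laurentX/laurent_u.
rewrite -[(_ ^ (size w)%:Z)]/(_ ^+ size w).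
have -> : (- A ^+ 3) ^+ size w = (- A ^+ 2) ^+ size w * A ^+ size w :> K.
  by rewrite -exprMn mulNr -exprSr.
rewrite -mulrA; apply: laurentM => //.
exact/laurentX/laurentN/laurent_A2.
Qed.

(** * Words read in a frieze *)

(** The entries of a frieze as a function of the chords (i, i + k) of a polygon, with
    rows of zeros added at the top and at the bottom; the diamond rule persists
    there, as [diamond] shows. *)
Definition chord (F : frieze) (i : int) (k : nat) : int :=
  if k is k'.+1 then
    if (k' <= (interior F).+1)%N then F k' (2 * i + k'%:Z + shift F) else 0
  else 0.

Arguments chord : simpl never.

Section CCF.
Variable F : frieze.
Hypothesis ccf : is_CCF F.
Notation m := (interior F).
Notation C := (chord F).

Lemma on_lattice_chord i k : on_lattice F k (2 * i + k%:Z + shift F) = (k <= m.+1)%N.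
Proof.
rewrite /on_lattice; have -> : 2 * i + k%:Z + shift F - k%:Z - shift F = 2 * i by ring.
by rewrite dvdz_mulr // andbT.
Qed.

Lemma chordS i k : (k <= m.+1)%N -> C i k.+1 = F k (2 * i + k%:Z + shift F).
Proof. by rewrite /chord => ->. Qed.

Lemma chord_gt0 i k : (0 < k <= m.+2)%N -> 0 < C i k.
Proof.
case: k => // k /andP[_ le]; rewrite chordS //; case: ccf => pos _ _ _.
by apply: pos; rewrite on_lattice_chord.
Qed.

Lemma chord1 i : C i 1 = 1.
Proof. by case: ccf => _ top _ _; rewrite chordS // top // on_lattice_chord. Qed.

Lemma chord_last i : C i m.+2 = 1.
Proof. by case: ccf => _ _ bot _; rewrite chordS // bot // on_lattice_chord. Qed.

Lemma chord_end i : C i m.+3 = 0.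
Proof. by rewrite /chord ltnn. Qed.

Lemma diamond i k : (k <= m.+1)%N ->
  C i k.+1 * C (i + 1) k.+1 - C (i + 1) k * C i k.+2 = 1.
Proof.
case: k => [|k] le; first by rewrite !chord1 mul0r subr0.
move: le; rewrite leq_eqVlt => /orP[/eqP [->]|lt].
  by rewrite chord_end mulr0 subr0 !chord_last.
case: ccf => _ _ _ /(_ k.+1 (2 * (i + 1) + k%:Z + shift F)).
rewrite on_lattice_chord => /(_ lt (leq_trans (leqnSn _) (ltnW lt))) D; rewrite -[RHS]D.
rewrite !chordS //; try exact: ltnW; last by rewrite ltnW // ltnW.
by congr (F _ _ * F _ _ - F _ _ * F _ _); lia.
Qed.

(** Subtracting two adjacent diamonds shows that the quotient of the left-hand side
    by C i (k + 1) does not depend on i when i + k is fixed; at k = 0 it is the quiddity of the vertex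
    i + k + 1, that is, the entry at the chord which cuts this vertex off. *)
Lemma right_rec i k : (k <= m.+1)%N ->
  C i k.+2 + C i k = C (i + k%:Z) 2 * C i k.+1.
Proof.
elim: k i => [|k IH] i le; first by rewrite !addr0 chord1 mulr1.
have d1 := diamond i le; have d2 := diamond i (ltnW le).
have {}IH := IH (i + 1) (ltnW le).
have pos : C (i + 1) k.+1 != 0 by rewrite gt_eqF // chord_gt0 //; lia.
apply: (mulfI pos); have -> : i + k.+1%:Z = i + 1 + k%:Z by lia.
move: d1 d2 IH; set q := C _ 2; set c3 := C i k.+3; set c2 := C i k.+2.
set c1 := C i k.+1; set e2 := C _ k.+2; set e1 := C _ k.+1; set e0 := C _ k.
move=> d1 d2 IH.
have : c2 * (e2 + e0) = c2 * (q * e1) by rewrite IH.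
by rewrite !mulrDr; lia.
Qed.

Lemma left_rec i k : (k <= m.+1)%N ->
  C (i - 1) k.+2 + C (i + 1) k = C (i - 1) 2 * C i k.+1.
Proof.
elim: k => [|k IH] le; first by rewrite !addr0 chord1 mulr1.
have d1 := diamond (i - 1) le; have d2 := diamond i (ltnW le).
have {}IH := IH (ltnW le).
have pos : C i k.+1 != 0 by rewrite gt_eqF // chord_gt0 //; lia.
apply: (mulfI pos); move: d1 d2 IH; rewrite subrK.
set q := C _ 2; set c3 := C (i - 1) k.+3; set c2 := C (i - 1) k.+2.
set c1 := C (i + 1) k.+1; set c0 := C (i + 1) k; set e2 := C i k.+2; set e1 := C _ k.+1.
move=> d1 d2 IH.
have : e2 * (c2 + c0) = e2 * (q * e1) by rewrite IH.
by rewrite !mulrDr; lia.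
Qed.

(** Along i + k both sides satisfy the same linear recursion of order two, by
    [right_rec] and [left_rec], with the same two initial values. *)
Lemma glide i k : (k <= m.+3)%N -> C i k = C (i + k%:Z) (m.+3 - k).
Proof.
move=> le; suff: C i k = C (i + k%:Z) (m.+3 - k) /\
    ((k < m.+3)%N -> C i k.+1 = C (i + k.+1%:Z) (m.+3 - k.+1)) by case.
elim: k le => [|k IH] le.
  by split=> [|_]; rewrite ?subn0 ?chord_end // subn1 chord1 chord_last.
have [IH1 /(_ le) IH2] := IH (ltnW le); split => // lt.
have r := @right_rec i k lt.
have l := @left_rec (i + k.+1%:Z) (m.+1 - k)%N (leq_subr _ _).
have E1 : i + k.+1%:Z - 1 = i + k%:Z by lia.
have E2 : i + k.+1%:Z + 1 = i + k.+2%:Z by lia.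
have e0 : (m.+3 - k.+2 = m.+1 - k)%N by lia.
have e1 : (m.+3 - k.+1 = (m.+1 - k).+1)%N by lia.
have e2 : (m.+3 - k = (m.+1 - k).+2)%N by lia.
by move: r l IH1 IH2; rewrite E1 E2 e0 e1 e2; lia.
Qed.

Lemma chord_period i k : (k <= m.+3)%N -> C (i + m.+3%:Z) k = C i k.
Proof.
move=> le; rewrite [RHS]glide // [RHS]glide ?leq_subr // subKn //.
by congr chord; lia.
Qed.

Lemma chord_periodz i k (t : int) : (k <= m.+3)%N -> C (i + m.+3%:Z * t) k = C i k.
Proof.
move=> le; elim: t => [|t IH|t IH] in i *; first by rewrite mulr0 addr0.
  by rewrite -[RHS]IH -[RHS]chord_period //; congr chord; lia.
by rewrite -[RHS]IH -[LHS]chord_period //; congr chord; lia.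
Qed.

Definition lshift (l : letter) : int := if l is L then -1 else 0.

(** A zigzag of ones as a sequence of nested chords (p k, p k + k + 1). *)
Definition chord_path (w : seq letter) (p : nat -> int) : Prop :=
  [/\ (size w).+1 = m, forall k, (0 < k <= m)%N -> C (p k) k.+1 = 1 &
    forall k, (0 < k <= size w)%N -> p k.+1 = p k + lshift (nth L w k.-1)].

(** If two zigzags separated, the diamond below the last common entry would have two
    ones side by side, hence a zero, although its entries are positive. *)
Lemma chord_path_unique w w' p p' : chord_path w p -> chord_path w' p' ->
  p 1%N = p' 1%N -> w = w'.
Proof.
move=> [sw ones st] [sw' ones' st'] E1.
have E k : (0 < k <= m)%N -> p k = p' k.
  elim: k => // k IH; case: (posnP k) => [->|k0] // /andP[_ lt].
  have {}IH := IH (introT andP (conj k0 (ltnW lt))).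
  have rk : (0 < k <= size w)%N by rewrite k0 -ltnS sw.
  have rk' : (0 < k <= size w')%N by rewrite k0 -ltnS sw'.
  have := ones k.+1 lt; have := ones' k.+1 lt; rewrite st // st' // -IH.
  (* The entry opposite to the last common one, which must not vanish. *)
have pos : 0 < C (p k - 1) k.+3 by apply: chord_gt0; rewrite /= !ltnS.
  have pos1 : 0 < C (p k) k.+1 by apply: chord_gt0; rewrite /= !ltnS; lia.
  have := @diamond (p k - 1) k.+1; rewrite subrK => /(_ (leqW lt)) d.
  case: (nth _ _ _); case: (nth _ _ _) => //=; rewrite addr0 => h1 h2;
    by move: d; rewrite h1 h2; nia.
apply: (eq_from_nth (x0 := L)) => [|j lt]; first by apply: succn_inj; rewrite sw sw'.
have r : (0 < j.+1 <= size w)%N by [].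
have r' : (0 < j.+1 <= size w')%N by lia.
have := st _ r; rewrite (E j.+2) ?(E j.+1) ?(st' _ r') -?sw //=; last by rewrite ltnW.
by case: (nth _ _ _); case: (nth _ _ _) => //=; lia.
Qed.

(** At either end of a chord with entry 1, the recursion writes the quiddity as a sum
    of two positive entries. *)
Lemma quiddity_ge2 i k : (1 < k <= m.+1)%N -> C i k = 1 ->
  (2 : int) <= C (i - 1) 2 /\ (2 : int) <= C (i + k%:Z - 1) 2.
Proof.
case: k => // k /andP[k0 le] E.
have l := left_rec i (ltnW le); have r := right_rec i (ltnW le).
have p1 : 0 < C (i - 1) k.+2 by apply: chord_gt0; rewrite /= !ltnS.
have p2 : 0 < C (i + 1) k by apply: chord_gt0; lia.
have p3 : 0 < C i k.+2 by apply: chord_gt0; rewrite /= !ltnS.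
have p4 : 0 < C i k by apply: chord_gt0; lia.
have e : i + k.+1%:Z - 1 = i + k%:Z by lia.
rewrite e; move: l r; rewrite E !mulr1 => <- <-.
by split; apply: lerD; rewrite -gtz0_ge1.
Qed.

(** Each step adds one vertex to the part of the polygon cut off by the chord, and
    this vertex is an end of the new chord. *)
Lemma chord_path_quiddity w p k (v : int) : chord_path w p -> (0 < k <= m)%N ->
  p k <= v -> v <= p k + k.+1%:Z -> v <> p 1%N + 1 -> (2 : int) <= C (v - 1) 2.
Proof.
move=> [sw ones st]; elim: k => // k IH /andP[_ lt] lo hi ne.
have [h1 h2] := @quiddity_ge2 (p k.+1) k.+2 (introT andP (conj isT lt)) (ones k.+1 lt).
have [->//|nlo] := eqVneq v (p k.+1).
have [->//|nhi] := eqVneq v (p k.+1 + k.+2%:Z).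
case: (posnP k) => [k0|k0]; first by subst k; lia.
have rk : (0 < k <= size w)%N by rewrite k0 -ltnS sw.
apply: IH ne; first (by rewrite k0 ltnW); move: lo hi nlo nhi; rewrite st //;
  by case: (nth _ _ _) => /=; lia.
Qed.

Lemma chord_path_shift w p t : chord_path w p ->
  chord_path w (fun k => p k + m.+3%:Z * t).
Proof.
case=> sw ones st; split=> // k r; last by rewrite st // addrAC.
by rewrite chord_periodz ?ones //; lia.
Qed.

(** The complementary part of the polygon, seen from the other ear: the chords come in
    the opposite order, and each step enlarges them at the other end. *)
Lemma chord_path_glide w p : chord_path w p ->
  chord_path (map flip (rev w)) (fun k => p (m.+1 - k)%N - k%:Z - 1).
Proof.
case=> sw ones st; split; first by rewrite size_map size_rev.
  move=> k /andP[k0 km].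
  have r : (0 < m.+1 - k <= m)%N by lia.
  have := ones _ r; rewrite glide; last lia.
  have -> : (m.+3 - (m.+1 - k).+1 = k.+1)%N by lia.
  rewrite -(@chord_period (_ - 1)); last lia.
  by move=> E; rewrite -[RHS]E; congr chord; lia.
move=> k; rewrite size_map size_rev => /andP[k0 km].
have -> : (m.+1 - k = (m.+1 - k.+1).+1)%N by lia.
rewrite st; last lia.
rewrite (nth_map L) ?size_rev; last lia.
rewrite nth_rev; last lia.
have -> : (size w - k.-1.+1 = (m.+1 - k.+1).-1)%N by lia.
by case: (nth _ _ _) => /=; lia.
Qed.

(** The zigzag w' starts at a vertex of quiddity 1.  Translated to one of the m + 3
    vertices from p m - 1 to p m + m + 1, it starts either at the first ear or at
    p m - 1, which is the ear at the other end of w. *)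
Lemma chord_path_word w w' p p' : chord_path w p -> chord_path w' p' ->
  w' = w \/ w' = map flip (rev w).
Proof.
move=> P P'; have [sw ones _] := P; have [sw' ones' _] := P'.
have m1 : (0 < 1 <= m)%N by rewrite -sw.
have mm : (0 < m <= m)%N by rewrite -sw leqnn.
have [t [r [Ed r0 rn]]] : exists t r : int,
    [/\ p' 1%N + 1 - (p m - 1) = t * m.+3%:Z + r, 0 <= r & r < m.+3%:Z].
  set d := _ - (p m - 1); exists (d %/ m.+3%:Z)%Z, (d %% m.+3%:Z)%Z.
  by split; [apply: divz_eq | apply: modz_ge0 | apply: ltz_pmod].
have P1 := chord_path_shift (- t) P'; have [_ ones1 _] := P1.
have E1 : p' 1%N + m.+3%:Z * - t = p m - 2 + r by rewrite mulrN mulrC; lia.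
have q1 : C (p m - 2 + r) 2 = 1 by rewrite -E1; apply: ones1.
have [rE|rN] := eqVneq r 0.
  right; apply: (chord_path_unique P1 (chord_path_glide P)).
  by rewrite E1 rE subn1 /=; lia.
left; apply: (chord_path_unique P1 P); rewrite E1.
have [e|ne] := eqVneq (p m - 1 + r) (p 1%N + 1); first lia.
have := @chord_path_quiddity w p m (p m - 1 + r) P mm.
have -> : p m - 1 + r - 1 = p m - 2 + r by lia.
rewrite q1 => h; suff : (2 <= 1 :> int) by [].
by apply: h; [lia | lia | apply/eqP].
Qed.

Lemma is_Gamma_path w : is_Gamma w F -> exists p, chord_path w p.
Proof.
case=> _ Em [z [ones st]].
have sw : (size w).+1 = m by rewrite Em.
pose p k := ((z k - k%:Z - shift F) %/ 2)%Z.
have zE k : (0 < k <= m)%N -> z k = 2 * p k + k%:Z + shift F.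
  move=> r; have [/andP[_ dv] _] := ones k r.
  by have := divzK dv; rewrite -/(p k); lia.
exists p; split => // k r.
  by rewrite chordS -?zE //; [have [_ ->] := ones k r | lia].
have := st k r; rewrite !zE; try lia.
by case: (nth _ _ _) => /=; lia.
Qed.

End CCF.

(** * Equivalent friezes *)

(** The vertical reflection v of a frieze reads the zigzag from bottom to top, the
    horizontal one h exchanges the directions. *)
Definition reflect_word (v h : bool) (w : seq letter) : seq letter :=
  let w1 := if v then map flip (rev w) else w in if h then map flip w1 else w1.

Lemma step_flip l : step (flip l) = - step l.
Proof. by case: l; rewrite ?opprK. Qed.

Lemma is_Gamma_equiv F G w : frieze_equiv F G -> is_CCF F -> is_Gamma w G ->
  exists v h, is_Gamma (reflect_word v h w) F.
Proof.
case=> EFG [v [h [t eqFG]]] ccf [_ Em [z [ones st]]]; rewrite -EFG in Em ones.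
exists v, h; split=> //.
  by rewrite Em /reflect_word; case: v {eqFG}; case: h => /=; rewrite ?size_map ?size_rev.
pose k' k := if v then ((interior F).+1 - k)%N else k.
pose y k := if h then - (z (k' k) - t) else z (k' k) - t.
exists y; split=> [k r|k].
  have kr : (k <= (interior F).+1)%N by lia.
  have := eqFG k (y k) kr; rewrite /= -/(k' k).
  have -> : (if h then - y k else y k) + t = z (k' k).
    by rewrite /y; case: (h); rewrite ?opprK subrK.
  have r' : (0 < k' k <= interior F)%N by rewrite /k'; case: (v); lia.
  by have [-> ->] := ones _ r'; case=> <- /(_ isT) <-.
have -> : size (reflect_word v h w) = size w.
  by rewrite /reflect_word; case: v {eqFG k' y}; case: h; rewrite ?size_map ?size_rev.
move=> r; have := st; rewrite /y /k' /reflect_word; case: (v) => {}st.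
  have r' : (0 < (interior F).+1 - k.+1 <= size w)%N by lia.
  have -> : ((interior F).+1 - k = ((interior F).+1 - k.+1).+1)%N by lia.
  have E : nth L (rev w) k.-1 = nth L w ((interior F).+1 - k.+1).-1.
    by rewrite nth_rev; [congr nth; lia | lia].
  rewrite (st _ r') -E; case: (h); rewrite ?(nth_map L) ?size_map ?size_rev ?step_flip; lia.
rewrite (st _ r); case: (h); rewrite ?(nth_map L) ?step_flip; lia.
Qed.

Lemma word_class_reflect v h w : word_class (reflect_word v h w) =i word_class w.
Proof.
move=> f; rewrite /reflect_word.
by case: v; case: h; rewrite ?word_class_flip ?word_class_rev.
Qed.

Lemma represents_word F alpha x s y r : represents F alpha x s y r ->
  exists w, [/\ alpha = rat_of_word w, is_Gamma w F & parents (rat_of_word w) x s y r].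
Proof.
by case=> _ [w /word_rat_of_word -> g] p; exists w.
Qed.

Lemma Gamma_class F G w w' : frieze_equiv F G -> is_Gamma w F -> is_Gamma w' G ->
  word_class w =i word_class w'.
Proof.
move=> FG gF gG; have ccf : is_CCF F by case: gF.
have [v [h g]] := is_Gamma_equiv FG ccf gG.
have [p P] := is_Gamma_path gF; have [p' P'] := is_Gamma_path g.
move=> f; rewrite -(word_class_reflect v h w').
by have [->|->] := chord_path_word ccf P P'; rewrite ?word_class_flip ?word_class_rev.
Qed.

Theorem corollary4p8 :
  (forall F : frieze, zigzag_type F ->
     exists (alpha : rat) (x s y r : int), represents F alpha x s y r)
  /\ (forall (F G : frieze) (alpha beta : rat) (x s y r x' s' y' r' : int),
        frieze_equiv F G ->
        represents F alpha x s y r -> represents G beta x' s' y' r' ->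
        forall f : K, Vclass alpha x y f <-> Vclass beta x' y' f)
  /\ (forall (F : frieze) (alpha : rat) (x s y r : int) (f : K),
        represents F alpha x s y r -> Vclass alpha x y f -> laurent_sqrt_t f).
Proof.
split; [|split].
- move=> F [w g]; have := parents_rat_of_word w; case: (farey w) => [[[x s] y] r] p.
  exists (rat_of_word w), x, s, y, r; split => //; first exact: rat_of_word_gt0_lt1.
  by exists w => //; apply: rat_of_wordP.
- move=> F G alpha beta x s y r x' s' y' r' FG.
  case/represents_word=> w [-> gF p] /represents_word[w' [-> gG p']] f.
  by rewrite (Vclass_word f p) (Vclass_word f p') (Gamma_class FG gF gG).
- move=> F alpha x s y r f /represents_word[w [-> _ p]] /(Vclass_word f p).
  by case/word_class_jones=> v ->; apply: laurent_jones.
Qed.
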